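(* For every integer $p \ge 2$, $$\boldsymbol{\lambda}\big(\mathcal{H}_{p,1}(\mathbb{S}^{1})\big) = (p+2) \left( \frac{8}{p+3}\Big( \frac{p}{p+1}\Big)^{\frac{p+3}{2}} + \frac{2}{p+1} -\frac{4}{p+3}\right)$$ and $$\boldsymbol{\lambda}\big(\mathfrak{P}_{p,1}(\mathbb{S}^{1})\big) = (p+1) \left( \frac{8(p+2)}{(p+1)(p+3)}\Big( \frac{p}{p+2}\Big)^{\frac{p+3}{2}} + \frac{4}{p+1} -\frac{4(p+2)}{(p+1)(p+3)}\right).$$ In particular, $$\lim_{p \to + \infty} \boldsymbol{\lambda}\big(\mathcal{H}_{p,1}(\mathbb{S}^{1})\big) = \frac{8}{\sqrt{e}} -2 \qquad\text{and}\qquad \lim_{p \to + \infty} \boldsymbol{\lambda}\big(\mathfrak{P}_{p,1}(\mathbb{S}^{1})\big) = \frac{8}{e}.$$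
   Context: $\mathbb{S}^{n-1}=\{z\in\mathbb{C}^n:\|z\|_2=1\}$ is the complex Euclidean sphere; in particular $\mathbb{S}^1$ denotes the unit sphere of $\mathbb{C}^2$ (the case $n=2$). For integers $p,q\ge0$, $\mathfrak{P}_{p,q}(\mathbb{C}^n)$ is the space of functions $f(z)=\sum_{|\alpha|=p,|\beta|=q}c_{(\alpha,\beta)}z^\alpha\overline{z}^\beta$ on $\mathbb{C}^n$ ($\alpha,\beta\in\mathbb{N}_0^n$, $c_{(\alpha,\beta)}\in\mathbb{C}$), and $\mathcal{H}_{p,q}(\mathbb{C}^n)$ is its subspace of those $f$ with $\Delta f=0$, where $\Delta=\sum_{j=1}^n\frac{\partial^2}{\partial z_j\partial\overline{z_j}}$. $\mathfrak{P}_{p,q}(\mathbb{S}^{n-1})$ and $\mathcal{H}_{p,q}(\mathbb{S}^{n-1})$ are the spaces of restrictions of these functions to $\mathbb{S}^{n-1}$, with the supremum norm (subspaces of $C(\mathbb{S}^{n-1})$, complex-valued functions). For a Banach space $Y$ and a closed complemented subspace $X\subset Y$, $\boldsymbol{\lambda}(X,Y)$ is the infimum of the norms of all bounded linear projections from $Y$ onto $X$. The (absolute) projection constant of a Banach space $X$ is $\boldsymbol{\lambda}(X)=\sup\boldsymbol{\lambda}(I(X),Y)$, the supremum over all Banach spaces $Y$ and isometric embeddings $I:X\to Y$. If $X$ is a finite-dimensional subspace of $C(K)$, then $\boldsymbol{\lambda}(X)=\boldsymbol{\lambda}(X,C(K))$. *)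

(* Defs.v *)
From HB Require Import structures.
From mathcomp Require Import all_boot all_order all_algebra.
From mathcomp Require Import all_classical all_reals all_analysis.
From mathcomp Require Import complex ring.

Set Implicit Arguments.
Unset Strict Implicit.
Unset Printing Implicit Defensive.

Import Order.TTheory GRing.Theory Num.Theory.
Import numFieldNormedType.Exports.

Local Open Scope classical_set_scope.
Local Open Scope complex_scope.
Local Open Scope ring_scope.

Section ProjectionConstants.
Variable R : realType.

(* The norm of a normed module over R[i] has its (real, nonnegative) values in
   R[i]; complex.Re reads them in R. *)
Definition opnorm (Y Z : normedModType R[i]) (P : Y -> Z) : \bar R :=
  ereal_sup [set (complex.Re `|P y|)%:E | y in [set y : Y | `|y| <= 1]].

Definition bounded_projection (Y : normedModType R[i]) (X : set Y)
    (P : {linear Y -> Y}) : Prop :=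
  [/\ (opnorm P < +oo)%E, range P = X & forall x, X x -> P x = x].

Definition rel_proj_const (Y : normedModType R[i]) (X : set Y) : \bar R :=
  ereal_inf [set opnorm P | P in [set P : {linear Y -> Y} |
                                   bounded_projection X P]].

Definition proj_const (X : normedModType R[i]) : \bar R :=
  ereal_sup [set l | exists (Y : completeNormedModType R[i])
                       (I : {linear X -> Y}),
    (forall x, `|I x| = `|x|) /\ l = rel_proj_const (range I)].

End ProjectionConstants.

Section SupNormSpaces.
Variable R : realType.

(* Linear spaces of bounded functions T -> R[i], which supspace_type turns into
   normed modules for the supremum norm. *)
Record supspace (T : Type) := SupSpace {
  supspace_set : set (T -> R[i]) ;
  supspace_submod : submod_closed (mem supspace_set) ;
  supspace_bounded : forall f, supspace_set f ->
    exists M : R, forall x, complex.Re `|f x| <= M }.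

Definition supspace_pred (T : Type) (X : supspace T) : {pred (T -> R[i])} :=
  mem (supspace_set X).

Definition supspace_type (T : Type) (X : supspace T) :=
  {f : T -> R[i] | f \in supspace_pred X}.

Definition supnorm (T : Type) (f : T -> R[i]) : R :=
  sup (range (fun x => complex.Re `|f x|)).

Lemma ReD (x y : R[i]) : complex.Re (x + y) = complex.Re x + complex.Re y.
Proof. by case: x; case: y. Qed.

Lemma Re_ler (x y : R[i]) : x <= y -> complex.Re x <= complex.Re y.
Proof. by rewrite lecE => /andP[]. Qed.

Lemma Re_normM (x y : R[i]) :
  complex.Re `|x * y| = complex.Re `|x| * complex.Re `|y|.
Proof. by rewrite normrM !normc_def -rmorphM. Qed.

Lemma Re_norm_ge0 (x : R[i]) : 0 <= complex.Re `|x|.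
Proof. by rewrite normc_def sqrtr_ge0. Qed.

Lemma Re_normK (V : normedZmodType R[i]) (x : V) : (complex.Re `|x|)%:C = `|x|.
Proof. by rewrite RRe_real// normr_real. Qed.

Lemma supnorm_empty (T : Type) (f : T -> R[i]) :
  ~ (exists x : T, True) -> supnorm f = 0.
Proof.
move=> T0; have E : range (fun x => complex.Re `|f x|) = set0.
  by rewrite -subset0 => t [x _ _]; case: T0; exists x.
by rewrite /supnorm E sup0.
Qed.

Section Instances.
Variables (T : Type) (X : supspace T).

HB.instance Definition _ :=
  GRing.isSubmodClosed.Build R[i] (T -> R[i]) (supspace_pred X)
    (supspace_submod X).
HB.instance Definition _ := [isSub of supspace_type X for @sval _ _].
HB.instance Definition _ := [Choice of supspace_type X by <:].
HB.instance Definition _ :=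
  GRing.SubChoice_isSubLmodule.Build R[i] (T -> R[i]) (supspace_pred X)
    (supspace_type X) (supspace_submod X).

Lemma supspace_has_ubound (f : supspace_type X) :
  has_ubound (range (fun x => complex.Re `|val f x|)).
Proof.
have [M fM] := supspace_bounded (set_mem (valP f)).
by exists M => _ [x _ <-].
Qed.

Lemma supnorm_ub (f : supspace_type X) x :
  complex.Re `|val f x| <= supnorm (val f).
Proof. by apply: ub_le_sup; [exact: supspace_has_ubound|exists x]. Qed.

Lemma supnorm_le (f : T -> R[i]) M : 0 <= M ->
  (forall x, complex.Re `|f x| <= M) -> supnorm f <= M.
Proof.
move=> M0 fM; have [[x0 _]|] := pselect (exists x : T, True).
  by apply: ge_sup; [exists (complex.Re `|f x0|), x0|move=> _ [x _ <-]].
by move=> T0; rewrite supnorm_empty.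
Qed.

Lemma supnorm_ge0 (f : supspace_type X) : 0 <= supnorm (val f).
Proof.
have [[x0 _]|T0] := pselect (exists x : T, True).
  by apply: le_trans (supnorm_ub f x0); exact: Re_norm_ge0.
by rewrite supnorm_empty.
Qed.

Definition supspace_norm (f : supspace_type X) : R[i] := (supnorm (val f))%:C.

Lemma supspace_normD (f g : supspace_type X) :
  supspace_norm (f + g) <= supspace_norm f + supspace_norm g.
Proof.
rewrite /supspace_norm -rmorphD lecR; apply: supnorm_le => [|x].
  by rewrite addr_ge0 ?supnorm_ge0.
apply: le_trans (lerD (supnorm_ub f x) (supnorm_ub g x)).
by rewrite -ReD; exact/Re_ler/ler_normD.
Qed.

Lemma supspace_normZ_le (l : R[i]) (f : supspace_type X) :
  supnorm (val (l *: f)) <= complex.Re `|l| * supnorm (val f).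
Proof.
apply: supnorm_le => [|x]; first by rewrite mulr_ge0 ?Re_norm_ge0 ?supnorm_ge0.
by rewrite [val _ _]/(l * val f x) Re_normM ler_wpM2l ?Re_norm_ge0 ?supnorm_ub.
Qed.

Lemma supspace_normZ (l : R[i]) (f : supspace_type X) :
  supspace_norm (l *: f) = `|l| * supspace_norm f.
Proof.
rewrite /supspace_norm -[`|l|]Re_normK -rmorphM; congr (_ %:C).
apply/le_anti; rewrite supspace_normZ_le andTb.
have [->|l0] := eqVneq l 0; first by rewrite normr0 mul0r supnorm_ge0.
have nl0 : 0 < complex.Re `|l| by rewrite -ltcR Re_normK normr_gt0.
rewrite -ler_pdivlMl//; have := supspace_normZ_le l^-1 (l *: f).
rewrite scalerA mulVf// scale1r => /le_trans; apply.
suff -> : complex.Re `|l^-1| = (complex.Re `|l|)^-1 by [].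
by apply: (mulfI (lt0r_neq0 nl0)); rewrite -Re_normM divff// normr1 divff ?lt0r_neq0.
Qed.

Lemma supspace_norm0 (f : supspace_type X) : supspace_norm f = 0 -> f = 0.
Proof.
move=> /complexI f0; apply/val_inj/funext => x; apply/eqP.
rewrite -normr_eq0 -Re_normK; apply/eqP; congr (_ %:C).
by apply/le_anti; rewrite Re_norm_ge0 andbT -f0 supnorm_ub.
Qed.

HB.instance Definition _ := Lmodule_isNormed.Build R[i] (supspace_type X)
  supspace_normD supspace_normZ supspace_norm0.

End Instances.
End SupNormSpaces.

Coercion supspace_type : supspace >-> Sortclass.

Lemma wirtinger_linD (K : comNzRingType) (l a b c d i u : K) :
  (l * a + c + i * (l * b + d)) * u =
  l * ((a + i * b) * u) + (c + i * d) * u.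
Proof. ring. Qed.

Lemma wirtinger_linB (K : comNzRingType) (l a b c d i u : K) :
  (l * a + c - i * (l * b + d)) * u =
  l * ((a - i * b) * u) + (c - i * d) * u.
Proof. ring. Qed.

Section Harmonics.
Variables (R : realType) (n : nat).

Definition l2norm (z : 'rV[R[i]]_n) : R :=
  Num.sqrt (\sum_i complex.Re `|z 0 i| ^+ 2).

(* S^{n-1} is the unit sphere of C^n: in particular S^1 is the case n = 2. *)
Definition csphere := {z : 'rV[R[i]]_n | l2norm z == 1}.

Definition bimonom (a b : 'I_n -> nat) (z : 'rV[R[i]]_n) : R[i] :=
  \prod_i (z 0 i ^+ a i * (z 0 i)^*%C ^+ b i).

(* A multi-index of order p has entries at most p, whence the finite type
   {ffun 'I_n -> 'I_p.+1}. *)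
Definition bihomog (p q : nat) : set ('rV[R[i]]_n -> R[i]) :=
  [set f | exists c : {ffun 'I_n -> 'I_p.+1} -> {ffun 'I_n -> 'I_q.+1} -> R[i],
    forall z, f z =
      \sum_(a : {ffun 'I_n -> 'I_p.+1} | (\sum_i a i)%N == p)
      \sum_(b : {ffun 'I_n -> 'I_q.+1} | (\sum_i b i)%N == q)
        c a b * bimonom (fun i => a i) (fun i => b i) z].

(* Derivative of f at z in the direction v over the reals. *)
Definition rderive (f : 'rV[R[i]]_n -> R[i]) (v z : 'rV[R[i]]_n) : R[i] :=
  derive1 (fun t : R => complex.Re (f (z + t%:C *: v))) 0 +i*
  derive1 (fun t : R => complex.Im (f (z + t%:C *: v))) 0.

(* Wirtinger derivatives d/dz_j and d/d(conj z_j), i.e. (d/dx_j -+ i d/dy_j) / 2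
   with the directions e_j and i e_j for x_j and y_j. *)
Definition dz (j : 'I_n) (f : 'rV[R[i]]_n -> R[i]) (z : 'rV[R[i]]_n) : R[i] :=
  (rderive f (delta_mx 0 j) z - 'i%C * rderive f ('i%C *: delta_mx 0 j) z) / 2.

Definition dzbar (j : 'I_n) (f : 'rV[R[i]]_n -> R[i]) (z : 'rV[R[i]]_n) : R[i] :=
  (rderive f (delta_mx 0 j) z + 'i%C * rderive f ('i%C *: delta_mx 0 j) z) / 2.

Definition laplacian (f : 'rV[R[i]]_n -> R[i]) (z : 'rV[R[i]]_n) : R[i] :=
  \sum_j dz j (dzbar j f) z.

Definition harmonic (p q : nat) : set ('rV[R[i]]_n -> R[i]) :=
  [set f | bihomog p q f /\ forall z, laplacian f z = 0].

Definition restr (F : set ('rV[R[i]]_n -> R[i])) : set (csphere -> R[i]) :=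
  [set (fun x : csphere => f (val x)) | f in F].

Lemma csphere_coord (x : csphere) i : `|val x 0 i| <= 1.
Proof.
case: x => x /= /eqP; rewrite /l2norm => xs.
have s1 : \sum_i complex.Re `|x 0 i| ^+ 2 = 1.
  by rewrite -[LHS]sqr_sqrtr ?xs ?expr1n// sumr_ge0// => j _; rewrite sqr_ge0.
rewrite -Re_normK -[leRHS]/((1 : R)%:C) lecR.
rewrite -(@ler_pXn2r _ 2) ?nnegrE ?Re_norm_ge0// expr1n -s1 (bigD1 i)//= lerDl.
by apply: sumr_ge0 => j _; rewrite sqr_ge0.
Qed.

Lemma norm_conjc (y : R[i]) : `|y^*%C| = `|y|.
Proof. by rewrite !normc_def; case: y => u w /=; rewrite sqrrN. Qed.

Lemma bimonom_le1 a b (x : csphere) : `|bimonom a b (val x)| <= 1.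
Proof.
rewrite normr_prod; apply: prodr_ile1 => i _.
rewrite normr_ge0 normrM !normrX norm_conjc/=.
by rewrite mulr_ile1 ?exprn_ge0 ?exprn_ile1 ?csphere_coord.
Qed.

Lemma bihomog_bounded p q (f : 'rV[R[i]]_n -> R[i]) : bihomog p q f ->
  exists M : R, forall x : csphere, complex.Re `|f (val x)| <= M.
Proof.
move=> [c fE].
exists (complex.Re
  (\sum_(a : {ffun 'I_n -> 'I_p.+1} | (\sum_i a i)%N == p)
   \sum_(b : {ffun 'I_n -> 'I_q.+1} | (\sum_i b i)%N == q) `|c a b|)) => x.
apply: Re_ler; rewrite fE; apply: le_trans (ler_norm_sum _ _ _) _.
apply: ler_sum => a _; apply: le_trans (ler_norm_sum _ _ _) _.
by apply: ler_sum => b _; rewrite normrM ler_piMr ?bimonom_le1.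
Qed.

Lemma bihomog0 p q : bihomog p q (fun=> 0).
Proof.
exists (fun _ _ => 0) => z; rewrite big1// => a _.
by rewrite big1// => b _; rewrite mul0r.
Qed.

Lemma bihomogDZ p q (l : R[i]) f g : bihomog p q f -> bihomog p q g ->
  bihomog p q (fun z => l * f z + g z).
Proof.
move=> [c fE] [d gE]; exists (fun a b => l * c a b + d a b) => z.
rewrite fE gE mulr_sumr -big_split; apply: eq_bigr => a _ /=.
rewrite mulr_sumr -big_split; apply: eq_bigr => b _ /=.
by rewrite mulrDl mulrA.
Qed.

(* The class of real polynomial maps, which contains bihomog p q and is stable
   under rderive; used to show that the Laplacian is linear on it. *)
Inductive rpoly : ('rV[R[i]]_n -> R[i]) -> Prop :=
| rpoly_cst c : rpoly (fun=> c)
| rpoly_coord i : rpoly (fun z => z 0 i)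
| rpoly_conj i : rpoly (fun z => (z 0 i)^*%C)
| rpoly_add f g : rpoly f -> rpoly g -> rpoly (fun z => f z + g z)
| rpoly_mul f g : rpoly f -> rpoly g -> rpoly (fun z => f z * g z).

Definition has_rderive (f : 'rV[R[i]]_n -> R[i]) v z (d : R[i]) : Prop :=
  is_derive (0 : R) 1 (fun t : R => complex.Re (f (z + t%:C *: v)))
    (complex.Re d) /\
  is_derive (0 : R) 1 (fun t : R => complex.Im (f (z + t%:C *: v)))
    (complex.Im d).

Lemma has_rderiveE f v z d : has_rderive f v z d -> rderive f v z = d.
Proof.
move=> [dR dI]; rewrite /rderive !derive1E.
by rewrite (@derive_val _ _ _ _ _ _ _ dR) (@derive_val _ _ _ _ _ _ _ dI); case: (d).
Qed.

Lemma has_rderiveD f g v z c d : has_rderive f v z c -> has_rderive g v z d ->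
  has_rderive (fun z => f z + g z) v z (c + d).
Proof.
move=> [fR fI] [gR gI]; split.
- rewrite ReD (_ : (fun t => _) = (fun t : R => complex.Re (f (z + t%:C *: v)))
    + (fun t : R => complex.Re (g (z + t%:C *: v)))); first exact: is_deriveD.
  by apply/funext => t; rewrite ReD.
- have ImD x y : complex.Im (x + y) = complex.Im x + complex.Im y :> R.
    by case: x; case: y.
  rewrite ImD (_ : (fun t => _) = (fun t : R => complex.Im (f (z + t%:C *: v)))
    + (fun t : R => complex.Im (g (z + t%:C *: v)))); first exact: is_deriveD.
  by apply/funext => t; rewrite ImD.
Qed.

Lemma has_rderiveM f g v z c d : has_rderive f v z c -> has_rderive g v z d ->
  has_rderive (fun z => f z * g z) v z (c * g z + f z * d).
Proof.
move=> [fR fI] [gR gI].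
have ReM x y : complex.Re (x * y) =
    complex.Re x * complex.Re y - complex.Im x * complex.Im y :> R.
  by case: x; case: y.
have ImM x y : complex.Im (x * y) =
    complex.Re x * complex.Im y + complex.Im x * complex.Re y :> R.
  by case: x; case: y.
have ImD x y : complex.Im (x + y) = complex.Im x + complex.Im y :> R.
  by case: x; case: y.
split.
- rewrite (_ : (fun t => _) =
    (fun t : R => complex.Re (f (z + t%:C *: v))) *
    (fun t : R => complex.Re (g (z + t%:C *: v))) -
    (fun t : R => complex.Im (f (z + t%:C *: v))) *
    (fun t : R => complex.Im (g (z + t%:C *: v)))); last first.
    by apply/funext => t; rewrite ReM.
  apply: is_derive_eq.
  rewrite !scale0r !addr0 ReD !ReM /GRing.scale/=.
  ring.
- rewrite (_ : (fun t => _) =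
    (fun t : R => complex.Re (f (z + t%:C *: v))) *
    (fun t : R => complex.Im (g (z + t%:C *: v))) +
    (fun t : R => complex.Im (f (z + t%:C *: v))) *
    (fun t : R => complex.Re (g (z + t%:C *: v)))); last first.
    by apply/funext => t; rewrite ImM.
  apply: is_derive_eq.
  rewrite !scale0r !addr0 ImD !ImM /GRing.scale/=.
  ring.
Qed.


Lemma has_rderive_cst c v z : has_rderive (fun=> c) v z 0.
Proof. by split; exact: is_derive_cst. Qed.

Lemma is_derive_affine (a b : R) : is_derive (0 : R) 1 (fun t : R => a + t * b) b.
Proof.
rewrite (_ : (fun t => _) = cst a + b *: (@id R)); last first.
  by apply/funext => t /=; congr (_ + _); rewrite mulrC.
have := is_deriveD (is_derive_cst a (0 : R) 1)
  (is_deriveZ b (is_derive_id (0 : R) 1)).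
by rewrite add0r /GRing.scale/= mulr1.
Qed.

Lemma has_rderive_coord i v z : has_rderive (fun z => z 0 i) v z (v 0 i).
Proof.
split.
- rewrite (_ : (fun t => _) =
    (fun t : R => complex.Re (z 0 i) + t * complex.Re (v 0 i))).
    exact: is_derive_affine.
  apply/funext => t; rewrite !mxE.
  by case: (z 0 i) (v 0 i) => a b [c d] /=; rewrite mul0r subr0.
- rewrite (_ : (fun t => _) =
    (fun t : R => complex.Im (z 0 i) + t * complex.Im (v 0 i))).
    exact: is_derive_affine.
  apply/funext => t; rewrite !mxE.
  by case: (z 0 i) (v 0 i) => a b [c d] /=; rewrite mul0r addr0.
Qed.

Lemma has_rderive_conj i v z : has_rderive (fun z => (z 0 i)^*%C) v z (v 0 i)^*%C.
Proof.
split.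
- rewrite (_ : (fun t => _) =
    (fun t : R => complex.Re (z 0 i)^*%C + t * complex.Re (v 0 i)^*%C)).
    exact: is_derive_affine.
  apply/funext => t; rewrite !mxE.
  by case: (z 0 i) (v 0 i) => a b [c d] /=; rewrite mul0r subr0.
- rewrite (_ : (fun t => _) =
    (fun t : R => complex.Im (z 0 i)^*%C + t * complex.Im (v 0 i)^*%C)).
    exact: is_derive_affine.
  apply/funext => t; rewrite !mxE.
  by case: (z 0 i) (v 0 i) => a b [c d] /=; rewrite mul0r addr0 opprD mulrN.
Qed.

Lemma rpoly_has_rderive f v : rpoly f ->
  exists2 g, rpoly g & forall z, has_rderive f v z (g z).
Proof.
elim=> [c|i|i|{}f g fp [f' f'p ff'] gp [g' g'p gg']
       |{}f g fp [f' f'p ff'] gp [g' g'p gg']].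
- by exists (fun=> 0) => [|z]; [exact: rpoly_cst|exact: has_rderive_cst].
- by exists (fun=> v 0 i) => [|z]; [exact: rpoly_cst|exact: has_rderive_coord].
- by exists (fun=> (v 0 i)^*%C) => [|z];
    [exact: rpoly_cst|exact: has_rderive_conj].
- by exists (fun z => f' z + g' z) => [|z];
    [exact: rpoly_add|exact: has_rderiveD].
- exists (fun z => f' z * g z + f z * g' z) => [|z]; last exact: has_rderiveM.
  by apply: rpoly_add; apply: rpoly_mul.
Qed.

Lemma rpoly_rderive f v : rpoly f -> rpoly (rderive f v).
Proof.
move=> /(rpoly_has_rderive v)[g gp fg].
by rewrite (_ : rderive f v = g)//; apply/funext => z; exact: has_rderiveE.
Qed.

Lemma has_rderive_rpoly f v z : rpoly f -> has_rderive f v z (rderive f v z).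
Proof.
by move=> /(rpoly_has_rderive v)[g _ fg]; rewrite (has_rderiveE (fg z)).
Qed.

Lemma rpoly_scale l f : rpoly f -> rpoly (fun z => l * f z).
Proof. by move=> fp; apply: rpoly_mul => //; exact: rpoly_cst. Qed.

Lemma rderive_lin l f g v z : rpoly f -> rpoly g ->
  rderive (fun z => l * f z + g z) v z = l * rderive f v z + rderive g v z.
Proof.
move=> fp gp; apply: has_rderiveE; apply: has_rderiveD; last first.
  exact: has_rderive_rpoly.
rewrite -[_ * _]add0r -[X in X + _](mul0r (f z)).
by apply: has_rderiveM; [exact: has_rderive_cst|exact: has_rderive_rpoly].
Qed.

Lemma rpoly_dzbar j f : rpoly f -> rpoly (dzbar j f).
Proof.
move=> fp; rewrite /dzbar.
apply: (@rpoly_mul (fun z => _ + _) (fun=> _)); last exact: rpoly_cst.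
apply: rpoly_add; first exact: rpoly_rderive.
by apply: rpoly_scale; exact: rpoly_rderive.
Qed.

Lemma dzbar_lin j l f g : rpoly f -> rpoly g ->
  dzbar j (fun z => l * f z + g z) = fun z => l * dzbar j f z + dzbar j g z.
Proof.
move=> fp gp; apply/funext => z; rewrite /dzbar !rderive_lin//.
exact: wirtinger_linD.
Qed.

Lemma dz_lin j l f g z : rpoly f -> rpoly g ->
  dz j (fun z => l * f z + g z) z = l * dz j f z + dz j g z.
Proof.
by move=> fp gp; rewrite /dz !rderive_lin//; exact: wirtinger_linB.
Qed.

Lemma laplacian_lin l f g z : rpoly f -> rpoly g ->
  laplacian (fun z => l * f z + g z) z = l * laplacian f z + laplacian g z.
Proof.
move=> fp gp; rewrite /laplacian mulr_sumr -big_split; apply: eq_bigr => j _.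
by rewrite dzbar_lin// dz_lin//; exact: rpoly_dzbar.
Qed.

Lemma rpoly_sum (I : Type) (r : seq I) (P : pred I) F :
  (forall i, rpoly (F i)) -> rpoly (fun z => \sum_(i <- r | P i) F i z).
Proof.
move=> Fp; elim: r => [|i r IH].
  rewrite (_ : (fun=> _) = fun=> 0); first exact: rpoly_cst.
  by apply/funext => z; rewrite big_nil.
have [Pi|nPi] := boolP (P i); last first.
  rewrite (_ : (fun=> _) = fun z => \sum_(j <- r | P j) F j z)//.
  by apply/funext => z; rewrite big_cons (negbTE nPi).
rewrite (_ : (fun=> _) = fun z => F i z + \sum_(j <- r | P j) F j z).
  exact: rpoly_add.
by apply/funext => z; rewrite big_cons Pi.
Qed.

Lemma rpoly_exp f k : rpoly f -> rpoly (fun z => f z ^+ k).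
Proof.
move=> fp; elim: k => [|k IH]; first exact: rpoly_cst.
rewrite (_ : (fun=> _) = fun z => f z * f z ^+ k); first exact: rpoly_mul.
by apply/funext => z; rewrite exprS.
Qed.

Lemma rpoly_bimonom a b : rpoly (bimonom a b).
Proof.
rewrite /bimonom; elim: (index_enum _) => [|i r IH].
  rewrite (_ : (fun=> _) = fun=> 1); first exact: rpoly_cst.
  by apply/funext => z; rewrite big_nil.
rewrite (_ : (fun=> _) = fun z : 'rV[R[i]]_n => (z 0 i ^+ a i * (z 0 i)^*%C ^+ b i) *
    \prod_(j <- r) (z 0 j ^+ a j * (z 0 j)^*%C ^+ b j)).
  apply: rpoly_mul => //; apply: rpoly_mul; apply: rpoly_exp.
    exact: rpoly_coord.
  exact: rpoly_conj.
by apply/funext => z; rewrite big_cons.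
Qed.

Lemma bihomog_rpoly p q f : bihomog p q f -> rpoly f.
Proof.
move=> [c /funext ->]; apply: rpoly_sum => a; apply: rpoly_sum => b.
exact/rpoly_scale/rpoly_bimonom.
Qed.

Lemma restr_submod (F : set ('rV[R[i]]_n -> R[i])) : F (fun=> 0) ->
  (forall (l : R[i]) f g, F f -> F g -> F (fun z => l * f z + g z)) ->
  submod_closed (mem (restr F)).
Proof.
move=> F0 Flin; split; first by rewrite inE; exists (fun=> 0).
move=> l f g /set_mem[f' Ff' <-] /set_mem[g' Fg' <-].
by apply/mem_set; exists (fun z => l * f' z + g' z) => //; exact: Flin.
Qed.

Lemma bihomog_restr_submod p q : submod_closed (mem (restr (bihomog p q))).
Proof.
apply: restr_submod => [|l f g]; first exact: bihomog0.
exact: bihomogDZ.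
Qed.

Lemma harmonic_restr_submod p q : submod_closed (mem (restr (harmonic p q))).
Proof.
apply: restr_submod => [|l f g [fp fh] [gp gh]].
  split=> [|z]; first exact: bihomog0.
  have E := laplacian_lin (-1) z (rpoly_cst 0) (rpoly_cst 0).
  rewrite -[RHS](addNr (laplacian (fun=> 0) z)) -mulN1r -E.
  congr (laplacian _ z).
  by apply/funext => y; rewrite mulr0 addr0.
split=> [|z]; first exact: bihomogDZ.
have E := laplacian_lin l z (bihomog_rpoly fp) (bihomog_rpoly gp).
by apply: (etrans E); rewrite fh gh mulr0 addr0.
Qed.

Lemma bihomog_restr_bounded p q f : restr (bihomog p q) f ->
  exists M : R, forall x : csphere, complex.Re `|f x| <= M.
Proof. by move=> [g /bihomog_bounded gp <-]. Qed.

Lemma harmonic_restr_bounded p q f : restr (harmonic p q) f ->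
  exists M : R, forall x : csphere, complex.Re `|f x| <= M.
Proof. by move=> [g [/bihomog_bounded gp _] <-]. Qed.

Definition bihomog_sphere (p q : nat) : supspace R csphere :=
  SupSpace (bihomog_restr_submod p q) (@bihomog_restr_bounded p q).

Definition harmonic_sphere (p q : nat) : supspace R csphere :=
  SupSpace (harmonic_restr_submod p q) (@harmonic_restr_bounded p q).

End Harmonics.

(* Main.v *)
Require Import Defs.
From HB Require Import structures.
From mathcomp Require Import all_boot all_order all_algebra.
From mathcomp Require Import all_classical all_reals all_analysis.
From mathcomp Require Import cyclic separable cyclotomic polyrcf complex ring lra.

(** Write [u = <z, x>]. Both spaces have a reproducing kernel of the form
    [k(z, x) = D u^(p-1) (A |u|^2 - p)] for the invariant probability on the
    sphere, and their projection constant is the integral of [|k(z, .)|], which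
    equals [int_0^1 D t^((p-1)/2) |A t - p| dt].

    Integration on the sphere is replaced by a mean [M], defined on all bounded
    functions as an ultrafilter limit of averages over grids; only its moments
    are ever needed. Given an isometric embedding of [X] in [Y], Hahn-Banach
    extends each point evaluation [delta_x] to a functional [phi_x] on [Y], and
    [y |-> M_x(k(., x) phi_x(y))] is a projection of norm at most [M |k|]. For
    the lower bound let [Y] be the space of all bounded functions on the sphere
    and [P] a projection onto [X]. If [h(z, w)] is a polynomial with [|h| <= 1]
    that maps [X] into itself, the pairing [M_z (P h(z, .))(z)] is at most
    [||P||] and does not depend on [P]: it equals [M_x M_z (h(z, x) k(z, x))].
    Taking for [h] approximations of the sign of [conj k] makes this tend to
    [M |k|]. Both halves use the same polynomial approximations of the square
    root, evaluated at [|k|^2]. *)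

Set Implicit Arguments.
Unset Strict Implicit.
Unset Printing Implicit Defensive.

Import Order.TTheory GRing.Theory Num.Theory.
Import numFieldNormedType.Exports.

Local Open Scope classical_set_scope.
Local Open Scope complex_scope.
Local Open Scope ring_scope.

(** * Means on bounded functions *)

(** The mean has to be total because [x |-> phi_x(y)] comes from a separate choice of extension at
    each point and has no regularity in [x]. The lower bound replaces the usual averaging of [P]
    over the unitary group, which would need Haar measure: since [h] has finite rank, [P h(z, .)] is
    a finite combination of fixed functions [P b], and linearity of [P] suffices to evaluate the
    pairing. What makes this work is that [h] is zonal, a combination of [<w, z>^(q+j) <z, w>^j]
    with [q = p-1]: on functions of bidegree [(p, 1)] each term acts as a combination of the
    identity and the Laplacian ([zonal_laplacian]), so both spaces are stable. Dimension two enters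
    through the uniform distribution of [|u|^2] on [[0, 1]], which turns means of polynomials in
    [|u|^2] into values of primitives; no integration theory is used. *)

Section ComplexParts.
Variable R : realType.
Implicit Types x y : R[i].

Lemma Im_addc x y : complex.Im (x + y) = complex.Im x + complex.Im y.
Proof. by case: x; case: y. Qed.

Lemma Re_scale (r : R) x : complex.Re (r%:C * x) = r * complex.Re x.
Proof. by case: x => a b /=; rewrite mul0r subr0. Qed.

Lemma Re_mulc x y : complex.Re (x * y) =
  complex.Re x * complex.Re y - complex.Im x * complex.Im y.
Proof. by case: x; case: y. Qed.

Lemma Im_mulc x y : complex.Im (x * y) =
  complex.Re x * complex.Im y + complex.Im x * complex.Re y.
Proof. by case: x; case: y. Qed.

Lemma ReIm_inj x y :
  complex.Re x = complex.Re y -> complex.Im x = complex.Im y -> x = y.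
Proof. by case: x; case: y => /= ? ? ? ? -> ->. Qed.

Lemma Re_norm_triangle (V : normedZmodType R[i]) (x y : V) :
  complex.Re `|x + y| <= complex.Re `|x| + complex.Re `|y|.
Proof. by rewrite -ReD; exact/Re_ler/ler_normD. Qed.

Lemma Re_norm_sum (I : Type) (r : seq I) (P : pred I) (F : I -> R[i]) :
  complex.Re `|\sum_(i <- r | P i) F i| <=
  \sum_(i <- r | P i) complex.Re `|F i|.
Proof.
elim/big_ind2: _ => [|x1 x2 y1 y2 h1 h2|//]; first by rewrite normr0.
by apply: le_trans (Re_norm_triangle _ _) _; exact: lerD.
Qed.

Lemma Re_normX x n : complex.Re `|x ^+ n| = complex.Re `|x| ^+ n.
Proof.
by elim: n => [|n IH]; rewrite ?expr0 ?normr1// !exprS Re_normM IH.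
Qed.

Lemma ler_norm_Re x : `|complex.Re x| <= complex.Re `|x|.
Proof. by rewrite -lecR Re_normK normc_ge_Re. Qed.

Lemma ler_norm_Im x : `|complex.Im x| <= complex.Re `|x|.
Proof.
rewrite normc_def /= -sqrtr_sqr ler_wsqrtr// lerDr; exact: sqr_ge0.
Qed.

Lemma Re_norm_sqr x : complex.Re `|x| ^+ 2 = complex.Re (x * x^*%C).
Proof.
by rewrite -sqr_normc -[in RHS]Re_normK -rmorphXn.
Qed.

Lemma norm_real (r : R) : complex.Re `|r%:C| = `|r|.
Proof. by rewrite normc_def /= expr0n addr0 sqrtr_sqr. Qed.

Lemma Re_sum (I : Type) (r : seq I) (P : pred I) (F : I -> R[i]) :
  complex.Re (\sum_(i <- r | P i) F i) = \sum_(i <- r | P i) complex.Re (F i).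
Proof. exact: (big_morph _ (@ReD R) erefl). Qed.

(** Multiplying by such a unimodular [c] turns bounds on real parts into bounds on moduli; complex
    estimates are reduced to real ones this way. *)
Lemma norm_rotation x :
  exists2 c : R[i], complex.Re `|c| = 1 & c * x = `|x|.
Proof.
have [->|x0] := eqVneq x 0; first by exists 1; rewrite ?normr1 ?mulr0 ?normr0.
have nx0 : `|x| != 0 by rewrite normr_eq0.
exists (x^*%C / `|x|).
  by rewrite normrM normfV normcJ normr_id divff.
by rewrite mulrAC [_^*%C * _]mulrC -sqr_normc expr2 mulfK.
Qed.

End ComplexParts.

Section BoundedFunctions.
Variables (R : realType) (T : Type).
Implicit Types f g : T -> R[i].

Definition bnd f := exists B : R, forall x, complex.Re `|f x| <= B.

Lemma bndD f g : bnd f -> bnd g -> bnd (fun x => f x + g x).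
Proof.
move=> [B fB] [B' gB]; exists (B + B') => x.
by apply: le_trans (Re_norm_triangle _ _) _; exact: lerD.
Qed.

Lemma bndM f g : bnd f -> bnd g -> bnd (fun x => f x * g x).
Proof.
move=> [B fB] [B' gB]; exists (B * B') => x.
by rewrite Re_normM ler_pM ?Re_norm_ge0.
Qed.

Lemma bnd_cst c : bnd (fun=> c).
Proof. by exists (complex.Re `|c|). Qed.

Lemma bndX f n : bnd f -> bnd (fun x => f x ^+ n).
Proof.
move=> fb; elim: n => [|n IH]; first exact: bnd_cst.
by under eq_fun do rewrite exprS; exact: bndM.
Qed.

Lemma bnd_sum (I : Type) (r : seq I) (P : pred I) (F : I -> T -> R[i]) :
  (forall i, bnd (F i)) -> bnd (fun x => \sum_(i <- r | P i) F i x).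
Proof.
move=> Fb; elim: r => [|i r IH].
  by under eq_fun do rewrite big_nil; exact: bnd_cst.
under eq_fun do rewrite big_cons.
by case: (P i) => //; apply: bndD.
Qed.

Lemma bnd_conj f : bnd f -> bnd (fun x => (f x)^*%C).
Proof. by move=> [B fB]; exists B => x; rewrite normcJ. Qed.

Lemma bnd_norm f : bnd f -> bnd (fun x => `|f x|).
Proof. by move=> [B fB]; exists B => x; rewrite normr_id. Qed.

End BoundedFunctions.

(** * Limits of bounded sequences along an ultrafilter *)

Section UltrafilterLimits.
Variable R : realType.

(** Refining [\oo] makes every ordinary limit a limit along the ultrafilter ([ulimE]), so moments
    that converge do not depend on the choice made here. *)
Lemma nat_ultrafilter_ex :
  exists U : set_system nat, UltraFilter U /\ \oo `<=` U.
Proof. exact: ultraFilterLemma. Qed.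

Definition nat_ultrafilter := projT1 (cid nat_ultrafilter_ex).

Instance nat_ultrafilter_ultra : UltraFilter nat_ultrafilter.
Proof. by case: (projT2 (cid nat_ultrafilter_ex)). Qed.

Lemma nat_ultrafilter_oo : \oo `<=` nat_ultrafilter.
Proof. by case: (projT2 (cid nat_ultrafilter_ex)). Qed.

(** The values stay in a compact segment, hence cluster at some [p]. The preimage of a neighbourhood
    of [p], or its complement, lies in the ultrafilter, and the second case contradicts
    clustering. *)
Lemma ultra_cvg (x : nat -> R) (B : R) : (forall n, `|x n| <= B) ->
  cvg (x @ nat_ultrafilter).
Proof.
move=> xB.
have FA : (x @ nat_ultrafilter) `[- B, B]%classic.
  apply: filterS (@filterT _ nat_ultrafilter _) => n _ /=.
  by rewrite in_itv /= -ler_norml.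
have [p [_ clp]] := @segment_compact R (- B) B (x @ nat_ultrafilter) _ FA.
apply/cvg_ex; exists p => V pV.
have [//|nV] := @in_ultra_setVsetC _ nat_ultrafilter (x @^-1` V) _.
by have [q [Vq nVq]] := clp (~` V) V nV pV.
Qed.

Definition ulim (x : nat -> R[i]) : R[i] :=
  lim ((fun n => complex.Re (x n)) @ nat_ultrafilter) +i*
  lim ((fun n => complex.Im (x n)) @ nat_ultrafilter).

Lemma ulim_cvg (x : nat -> R[i]) : bnd x ->
  ((fun n => complex.Re (x n)) @ nat_ultrafilter --> complex.Re (ulim x)) /\
  ((fun n => complex.Im (x n)) @ nat_ultrafilter --> complex.Im (ulim x)).
Proof.
move=> [B xB]; split; apply: (@ultra_cvg _ B) => n; apply: le_trans (xB n).
  exact: ler_norm_Re.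
exact: ler_norm_Im.
Qed.

Lemma ulimE (x : nat -> R[i]) (l : R[i]) :
  (fun n => complex.Re (x n)) @ \oo --> complex.Re l ->
  (fun n => complex.Im (x n)) @ \oo --> complex.Im l -> ulim x = l.
Proof.
move=> xr xi; apply: ReIm_inj; apply: cvg_lim => //.
  exact: cvg_trans (cvg_app _ nat_ultrafilter_oo) xr.
exact: cvg_trans (cvg_app _ nat_ultrafilter_oo) xi.
Qed.

Lemma ulimD x y : bnd x -> bnd y -> ulim (fun n => x n + y n) = ulim x + ulim y.
Proof.
move=> /ulim_cvg[xr xi] /ulim_cvg[yr yi].
apply: ReIm_inj; apply: cvg_lim => //.
  rewrite ReD; under eq_fun do rewrite ReD; exact: cvgD xr yr.
rewrite Im_addc; under eq_fun do rewrite Im_addc; exact: cvgD xi yi.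
Qed.

Lemma ulimZ c x : bnd x -> ulim (fun n => c * x n) = c * ulim x.
Proof.
move=> /ulim_cvg[xr xi]; apply: ReIm_inj; apply: cvg_lim => //.
  rewrite Re_mulc; under eq_fun do rewrite Re_mulc.
  by apply: cvgB; apply: cvgM => //; exact: cvg_cst.
rewrite Im_mulc; under eq_fun do rewrite Im_mulc.
by apply: cvgD; apply: cvgM => //; exact: cvg_cst.
Qed.

Lemma ulim_mono x y : bnd x -> bnd y ->
  (forall n, complex.Re (x n) <= complex.Re (y n)) ->
  complex.Re (ulim x) <= complex.Re (ulim y).
Proof.
move=> /ulim_cvg[xr _] /ulim_cvg[yr _] xy.
by apply: (ler_cvg_to xr yr); exact: nearW.
Qed.

End UltrafilterLimits.

Record mean (R : realType) (T : Type) := Mean {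
  mean_fun :> (T -> R[i]) -> R[i] ;
  meanD : forall f g, bnd f -> bnd g ->
    mean_fun (fun x => f x + g x) = mean_fun f + mean_fun g ;
  meanZ : forall c f, bnd f -> mean_fun (fun x => c * f x) = c * mean_fun f ;
  mean_mono : forall f g, bnd f -> bnd g ->
    (forall x, complex.Re (f x) <= complex.Re (g x)) ->
    complex.Re (mean_fun f) <= complex.Re (mean_fun g) ;
  mean_cst : forall c, mean_fun (fun=> c) = c }.

Arguments mean_fun {R T} m f : simpl never.

Section MeanTheory.
Variables (R : realType) (T : Type) (M : mean R T).
Implicit Types f g : T -> R[i].

Lemma mean_norm f : bnd f ->
  complex.Re `|M f| <= complex.Re (M (fun x => `|f x|)).
Proof.
move=> fb; have [c c1 cE] := norm_rotation (M f).
rewrite -cE -meanZ//; apply: (@mean_mono _ _ M) => [||x].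
- by apply: bndM => //; exact: bnd_cst.
- exact: bnd_norm.
apply: le_trans (ler_norm _) _; apply: le_trans (ler_norm_Re _) _.
by rewrite Re_normM c1 mul1r.
Qed.

Lemma mean_le f (B : R) : (forall x, complex.Re `|f x| <= B) ->
  complex.Re `|M f| <= B.
Proof.
move=> fB; have fb : bnd f by exists B.
apply: le_trans (mean_norm fb) _.
have -> : B = complex.Re (M (fun=> B%:C)) by rewrite mean_cst.
by apply: (@mean_mono _ _ M) => //; [exact: bnd_norm|exact: bnd_cst].
Qed.

Lemma meanZr c f : bnd f -> M (fun x => f x * c) = M f * c.
Proof. by move=> fb; under eq_fun do rewrite mulrC; rewrite meanZ// mulrC. Qed.

Lemma mean_sum (I : Type) (r : seq I) (P : pred I) (F : I -> T -> R[i]) :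
  (forall i, bnd (F i)) ->
  M (fun x => \sum_(i <- r | P i) F i x) = \sum_(i <- r | P i) M (F i).
Proof.
move=> Fb; elim: r => [|i r IH].
  by under eq_fun do rewrite big_nil; rewrite mean_cst big_nil.
under eq_fun do rewrite big_cons; rewrite big_cons.
by case: (P i) => //; rewrite meanD ?IH//; exact: bnd_sum.
Qed.

End MeanTheory.

(** * Means as ultrafilter limits of finite averages *)

Section UltrafilterMean.
Variables (R : realType) (T : Type) (I : nat -> finType).
Variables (pt : forall N, I N -> T).
Hypothesis I_gt0 : forall N, (0 < #|I N|)%N.

Definition average N (f : T -> R[i]) : R[i] :=
  ((#|I N|%:R)^-1)%:C * \sum_(i : I N) f (pt i).

Let card_gt0 N : (0 : R) < #|I N|%:R. Proof. by rewrite ltr0n. Qed.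

Lemma average_cst N c : average N (fun=> c) = c.
Proof.
rewrite /average sumr_const -[c *+ _]mulr_natl mulrA -(rmorph_nat (real_complex R)).
by rewrite -rmorphM mulVf ?mul1r// lt0r_neq0.
Qed.

Lemma bnd_average f : bnd f -> bnd (average ^~ f).
Proof.
move=> [B fB]; exists B => N.
rewrite /average Re_normM norm_real ger0_norm ?invr_ge0 ?ler0n//.
rewrite mulrC ler_pdivrMr//.
apply: le_trans (Re_norm_sum _ _ _) _.
apply: le_trans (ler_sum _ (fun i _ => fB (pt i))) _.
by rewrite sumr_const mulr_natr.
Qed.

Lemma averageD N f g :
  average N (fun x => f x + g x) = average N f + average N g.
Proof. by rewrite /average big_split mulrDr. Qed.

Lemma averageZ N c f : average N (fun x => c * f x) = c * average N f.
Proof. by rewrite /average -mulr_sumr mulrCA. Qed.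

Lemma average_mono N f g : (forall x, complex.Re (f x) <= complex.Re (g x)) ->
  complex.Re (average N f) <= complex.Re (average N g).
Proof.
move=> fg; rewrite /average !Re_scale ler_wpM2l ?invr_ge0 ?ler0n// !Re_sum.
exact: ler_sum.
Qed.

Definition umean_fun f : R[i] := ulim (average ^~ f).

Lemma umeanD f g : bnd f -> bnd g ->
  umean_fun (fun x => f x + g x) = umean_fun f + umean_fun g.
Proof.
move=> fb gb; rewrite /umean_fun; under eq_fun do rewrite averageD.
by rewrite ulimD//; exact: bnd_average.
Qed.

Lemma umeanZ c f : bnd f -> umean_fun (fun x => c * f x) = c * umean_fun f.
Proof.
move=> fb; rewrite /umean_fun; under eq_fun do rewrite averageZ.
by rewrite ulimZ//; exact: bnd_average.
Qed.

Lemma umean_mono f g : bnd f -> bnd g ->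
  (forall x, complex.Re (f x) <= complex.Re (g x)) ->
  complex.Re (umean_fun f) <= complex.Re (umean_fun g).
Proof.
move=> fb gb fg; apply: ulim_mono; [exact: bnd_average|exact: bnd_average|].
by move=> N; exact: average_mono.
Qed.

Lemma umean_cst c : umean_fun (fun=> c) = c.
Proof.
rewrite /umean_fun; under eq_fun do rewrite average_cst.
by apply: ulimE; exact: cvg_cst.
Qed.

Definition umean : mean R T := Mean umeanD umeanZ umean_mono umean_cst.

End UltrafilterMean.

(** * The complex Hahn-Banach theorem *)

Lemma Re_normZ (R : realType) (Y : normedModType R[i]) (r : R) (y : Y) :
  complex.Re `|r%:C *: y| = `|r| * complex.Re `|y|.
Proof.
rewrite normrZ -[in LHS](Re_normK y) -[in LHS](Re_normK r%:C) norm_real.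
by rewrite -rmorphM.
Qed.

Lemma Re_normZ_ge0 (R : realType) (Y : normedModType R[i]) (r : R) (y : Y) :
  0 <= r -> r * complex.Re `|y| = complex.Re `|r%:C *: y|.
Proof. by move=> r0; rewrite Re_normZ ger0_norm. Qed.

Section RealHahnBanach.
Variables (R : realType) (Y : normedModType R[i]).
Local Notation N y := (complex.Re `|y|).

(** Partial functionals are encoded by graphs, so that the upper bound of a chain is a union.
    Single-valuedness is not imposed: it follows from domination ([graph_functional]). *)
Definition graph_linear (G : set (Y * R)) := forall (r : R) p q, G p -> G q ->
  G (r%:C *: p.1 + q.1, r * p.2 + q.2).

Definition graph_dominated (G : set (Y * R)) := forall p, G p -> p.2 <= N p.1.

Definition one_step (H : set (Y * R)) (y0 : Y) (c : R) : set (Y * R) :=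
  [set p | exists r q, H q /\ p = (r%:C *: y0 + q.1, r * c + q.2)].

Lemma one_step_linear H y0 c : graph_linear H -> graph_linear (one_step H y0 c).
Proof.
move=> Hl r _ _ [s [p [Hp ->]]] [t [q [Hq ->]]] /=.
exists (r * s + t), (r%:C *: p.1 + q.1, r * p.2 + q.2); split; first exact: Hl.
congr (_, _) => /=; last by ring.
by rewrite scalerDr scalerA -rmorphM rmorphD scalerDl addrACA.
Qed.

Lemma graph_linearZ H (r : R) p : graph_linear H -> H (0, 0) -> H p ->
  H (r%:C *: p.1, r * p.2).
Proof. by move=> Hl H0 Hp; have := Hl r _ _ Hp H0; rewrite !addr0. Qed.

(** By the triangle inequality every [p.2 - N (p.1 - y0)] lies below every [N (q.1 + y0) - q.2], and
    any [c] in between works; the supremum of the former is taken. Homogeneity reduces the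
    coefficient of [y0] to 1 or -1. *)
Lemma one_step_dominated H y0 : graph_linear H -> graph_dominated H ->
  H (0, 0) -> exists c, graph_dominated (one_step H y0 c).
Proof.
move=> Hl Hd H0.
have key p q : H p -> H q -> p.2 - N (p.1 - y0) <= N (q.1 + y0) - q.2.
  move=> Hp Hq; rewrite lerBlDr addrAC lerBrDr.
  have := Hd _ (Hl 1 _ _ Hp Hq); rewrite /= scale1r mul1r => /le_trans; apply.
  rewrite (_ : p.1 + q.1 = (q.1 + y0) + (p.1 - y0)); first exact: Re_norm_triangle.
  by rewrite addrACA subrr addr0 addrC.
pose S := [set p.2 - N (p.1 - y0) | p in H].
have Sub q : H q -> ubound S (N (q.1 + y0) - q.2).
  by move=> Hq _ [p Hp <-]; exact: key.
have S0 : S !=set0 by exists (0 - N (0 - y0)), (0, 0).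
have Ssup : has_sup S by split => //; exists (N (0 + y0) - 0); exact: (Sub _ H0).
pose c := sup S.
have cL p : H p -> p.2 - N (p.1 - y0) <= c.
  by move=> Hp; apply: ub_le_sup; [case: Ssup|exists p].
have cU q : H q -> c <= N (q.1 + y0) - q.2.
  by move=> Hq; apply: ge_sup => //; exact: Sub.
exists c => _ [r [q [Hq ->]]] /=.
have [r0|r0|->] := ltgtP r 0; last 1 first.
- by rewrite mul0r scale0r !add0r; exact: Hd.
- pose s := - r; have s0 : 0 < s by rewrite oppr_gt0.
  have := cL _ (graph_linearZ s^-1 Hl H0 Hq) => /=.
  rewrite -(ler_pM2l s0) mulrBr mulVKf ?lt0r_neq0//.
  rewrite Re_normZ_ge0 ?(ltW s0)// scalerBr scalerA -rmorphM.
  rewrite divff ?lt0r_neq0// scale1r /s => h.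
  rewrite (_ : r%:C *: y0 + q.1 = q.1 - (- r)%:C *: y0); first lra.
  by rewrite rmorphN scaleNr opprK addrC.
- have := cU _ (graph_linearZ r^-1 Hl H0 Hq) => /=.
  rewrite -(ler_pM2l r0) mulrBr mulVKf ?lt0r_neq0//.
  rewrite Re_normZ_ge0 ?(ltW r0)// scalerDr scalerA -rmorphM.
  rewrite divff ?lt0r_neq0// scale1r => h.
  by rewrite -lerBrDr [_ + q.1]addrC.
Qed.

(** Subtracting the two pairs puts [(0, b - a)] in the graph, and domination bounds its value by the
    norm of 0; then exchange [a] and [b]. *)
Lemma graph_functional H y a b : graph_linear H -> graph_dominated H ->
  H (y, a) -> H (y, b) -> a = b.
Proof.
move=> Hl Hd.
have le a' b' : H (y, a') -> H (y, b') -> b' <= a'.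
  move=> Ha Hb; have := Hd _ (Hl (-1) _ _ Ha Hb).
  by rewrite /= rmorphN scaleN1r addNr normr0 mulN1r addrC subr_le0.
by move=> Ha Hb; apply/eqP; rewrite eq_le !le.
Qed.

Lemma real_hahn_banach (G0 : set (Y * R)) : graph_linear G0 ->
  graph_dominated G0 -> G0 (0, 0) ->
  exists psi : Y -> R,
    [/\ forall r x y, psi (r%:C *: x + y) = r * psi x + psi y,
        forall p, G0 p -> psi p.1 = p.2 & forall y, psi y <= N y].
Proof.
move=> G0l G0d G00.
(* The union with [G0] is built into [P] because Zorn's lemma also meets the empty chain, whose
   union is empty. *)
pose P := [set A : set (Y * R) | graph_linear (A `|` G0) /\
  graph_dominated (A `|` G0)].
have [A [[Al Ad] Amax]] : exists A, P A /\ forall B, A `<` B -> ~ P B.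
  apply: Zorn_bigcup => F FP Ftot; split.
  - move=> r p q Fp Fq.
    suff [[A [FA Ap Aq]]|[G0p G0q]] :
        (exists A, [/\ F A, (A `|` G0) p & (A `|` G0) q]) \/ (G0 p /\ G0 q).
    + have [Al _] := FP _ FA; have [Al'|] := Al r p q Ap Aq; last by right.
      by left; exists A.
    + by right; exact: G0l.
    case: Fp => [[A FA Ap]|G0p]; case: Fq => [[B FB Bq]|G0q]; last by right.
    + left; have [AB|BA] := Ftot _ _ FA FB.
        by exists B; split => //; [left; exact: AB|left].
      by exists A; split => //; [left|left; exact: BA].
    + by left; exists A; split => //; [left|right].
    + by left; exists B; split => //; [right|left].
  - move=> p [[A FA Ap]|]; last exact: G0d.
    by have [_ Ad] := FP _ FA; apply: Ad; left.
set H := A `|` G0 in Al Ad.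
have H00 : H (0, 0) by right.
(* If [y0] had no value, the one-step extension at [y0] would be strictly larger than [A] and still
   satisfy [P]. *)
have Htot y0 : exists a, H (y0, a).
  have [c Bd] := one_step_dominated y0 Al Ad H00.
  have Bl := @one_step_linear H y0 c Al.
  set B := one_step H y0 c in Bd Bl.
  have HB : H `<=` B.
    move=> [y a] Hya; exists 0, (y, a); split => //.
    by rewrite scale0r mul0r !add0r.
  have By0 : B (y0, c).
    by exists 1, (0, 0); split => //; rewrite scale1r mul1r !addr0.
  have BG0 : B `|` G0 = B by apply: setUidl => p G0p; apply: HB; right.
  apply: contrapT => nH; apply: (Amax B); last by rewrite /P /= BG0.
  split; first by move=> p Ap; apply: HB; left.
  by move=> /(_ _ By0) Ay0; apply: nH; exists c; left.
pose psi y := projT1 (cid (Htot y)).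
have psiH y : H (y, psi y) by exact: (projT2 (cid (Htot y))).
exists psi; split.
- move=> r x y; apply: (graph_functional Al Ad (psiH _)).
  exact: (Al r _ _ (psiH x) (psiH y)).
- move=> [y a] G0p /=; apply: (graph_functional Al Ad (psiH _)); by right.
- by move=> y; exact: (Ad _ (psiH y)).
Qed.

End RealHahnBanach.

(** A complex functional is determined by its real part [psi]: its value at [y] must be
    [psi y - i psi (i y)]. The bound on [psi] passes to the modulus after rotating that value onto
    the positive axis. *)
Lemma complex_hahn_banach (R : realType) (X : lmodType R[i])
    (Y : normedModType R[i]) (I : {linear X -> Y}) (f : X -> R[i]) :
  (forall a x y, f (a *: x + y) = a * f x + f y) ->
  (forall x, complex.Re `|f x| <= complex.Re `|I x|) ->
  exists phi : Y -> R[i],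
    [/\ forall a x y, phi (a *: x + y) = a * phi x + phi y,
        forall x, phi (I x) = f x &
        forall y, complex.Re `|phi y| <= complex.Re `|y|].
Proof.
move=> fl fI.
pose G0 : set (Y * R) := [set (I x, complex.Re (f x)) | x in setT].
have f0 : f 0 = 0.
  by have := fl (-1) 0 0; rewrite scaler0 addr0 mulN1r addNr.
have [||| psi [psil psiG psiN]] := @real_hahn_banach R Y G0.
- move=> r _ _ [x _ <-] [y _ <-] /=; exists (r%:C *: x + y) => //.
  by rewrite linearP fl ReD Re_scale.
- move=> _ [x _ <-] /=; apply: le_trans (fI x).
  by apply: le_trans (ler_norm _) _; exact: ler_norm_Re.
- by exists 0 => //; rewrite linear0 f0.
have psi0 : psi 0 = 0.
  by have := psil (-1) 0 0; rewrite scaler0 addr0 mulN1r addNr.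
have psiD x y : psi (x + y) = psi x + psi y.
  by rewrite -{1}[x]scale1r psil mul1r.
have psiZ r x : psi (r%:C *: x) = r * psi x.
  by rewrite -[r%:C *: x]addr0 psil psi0 addr0.
pose phi y : R[i] := psi y +i* - psi ('i%C *: y).
have phiD x y : phi (x + y) = phi x + phi y.
  by apply: ReIm_inj; rewrite /phi ?ReD ?Im_addc /= ?scalerDr psiD// opprD.
have phiZ a x : phi (a *: x) = a * phi x.
  have -> : a *: x = (complex.Re a)%:C *: x + (complex.Im a)%:C *: ('i%C *: x).
    by rewrite scalerA -scalerDl [_ * 'i%C]mulrC -complexE.
  have i2 : 'i%C *: ('i%C *: x) = - x.
    by rewrite scalerA -expr2 sqr_i scaleN1r.
  have icomm (r : R) y : 'i%C *: (r%:C *: y) = r%:C *: ('i%C *: y).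
    by rewrite !scalerA mulrC.
  have psi_opp x' : psi (- x') = - psi x'.
    by rewrite -scaleN1r -(rmorph1 (real_complex R)) -rmorphN psiZ mulN1r.
  apply: ReIm_inj.
    by rewrite Re_mulc /phi /= psiD !psiZ; ring.
  rewrite Im_mulc /phi /= scalerDr psiD !icomm !psiZ.
  by rewrite i2 psi_opp; ring.
exists phi; split.
- by move=> a x y; rewrite phiD phiZ.
- move=> x; apply: ReIm_inj; rewrite /phi /=.
    by have := psiG _ (ex_intro2 _ _ x Logic.I erefl).
  rewrite -linearZ.
  have /= -> := psiG _ (ex_intro2 _ _ ('i%C *: x) Logic.I erefl).
  have := fl 'i%C x 0; rewrite f0 !addr0 => ->.
  by rewrite Re_mulc /=; ring.
- move=> y; have [c c1 cE] := norm_rotation (phi y).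
  rewrite -cE -phiZ /phi /=; apply: le_trans (psiN _) _.
  rewrite normrZ -[`|y| in leLHS]Re_normK -[`|c|]Re_normK c1.
  by rewrite -rmorphM mul1r.
Qed.

(** * Spaces with the supremum norm *)

Lemma Re_norm_le_add (R : realType) (x : R[i]) :
  complex.Re `|x| <= `|complex.Re x| + `|complex.Im x|.
Proof.
rewrite {1}(complexE x); apply: le_trans (Re_norm_triangle _ _) _.
rewrite Re_normM !norm_real.
by rewrite (_ : complex.Re `|'i%C| = 1) ?mul1r// normc_def /= expr0n add0r
  expr1n sqrtr1.
Qed.

Lemma supspace_norm_le (R : realType) (T : Type) (X : supspace R T) (f : X)
    (M : R) : 0 <= M ->
  (forall x, complex.Re `|val f x| <= M) -> complex.Re `|f| <= M.
Proof. exact: supnorm_le. Qed.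

Lemma supspace_norm_ub (R : realType) (T : Type) (X : supspace R T) (f : X) x :
  complex.Re `|val f x| <= complex.Re `|f|.
Proof. exact: supnorm_ub. Qed.

Section BoundedFunctionSpace.
Variables (R : realType) (T : Type).

Lemma bnd_submod : submod_closed (mem [set f : T -> R[i] | bnd f]).
Proof.
split; first by apply/mem_set; exact: bnd_cst.
move=> l f g /set_mem fb /set_mem gb; apply/mem_set.
by apply: bndD => //; apply: bndM => //; exact: bnd_cst.
Qed.

Definition bounded_functions : supspace R T :=
  SupSpace bnd_submod (fun f fb => fb).

Local Notation B := (supspace_type bounded_functions).

(** The limit is built pointwise from the limits of real and imaginary parts, both 1-Lipschitz;
    uniformity in [x] is inherited from the Cauchy condition. *)
Lemma bounded_functions_complete (F : set_system B) :
  ProperFilter F -> cauchy F -> cvg F.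
Proof.
move=> FF /cauchyP Fc.
have Fe (e : R) : 0 < e -> exists f0 : B,
    F [set f | forall x, complex.Re `|val f0 x - val f x| <= e].
  move=> e0; have [|f0 Ff0] := Fc e%:C; first by rewrite ltcR.
  exists f0; apply: filterS Ff0 => f; rewrite -ball_normE /= => ff x.
  apply: le_trans (supspace_norm_ub (f0 - f) x) _.
  by have /ltW/Re_ler := ff.
pose part (h : R[i] -> R) x (f : B) : R := h (val f x).
have lim_ex (h : R[i] -> R) x : (forall a b, `|h a - h b| <= complex.Re `|a - b|) ->
    cvg (part h x @ F).
  move=> hl; apply: R_complete; apply: cauchy_exP => e e0.
  have [|f0 Ff0] := Fe (e / 2); first by rewrite divr_gt0.
  exists (h (val f0 x)).
  change (F [set f | ball (h (val f0 x)) e (part h x f)]).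
  apply: filterS Ff0 => f /(_ x) ff.
  rewrite -ball_normE /=; apply: le_lt_trans (hl _ _) _.
  by apply: le_lt_trans ff _; lra.
have ReB (a b : R[i]) : complex.Re (a - b) = complex.Re a - complex.Re b.
  by case: a; case: b.
have ImB (a b : R[i]) : complex.Im (a - b) = complex.Im a - complex.Im b.
  by case: a; case: b.
have Re_ex x := lim_ex (@complex.Re R) x
  (fun a b => eq_ind _ (fun t => `|t| <= _) (ler_norm_Re (a - b)) _ (ReB a b)).
have Im_ex x := lim_ex (@complex.Im R) x
  (fun a b => eq_ind _ (fun t => `|t| <= _) (ler_norm_Im (a - b)) _ (ImB a b)).
pose g x : R[i] := lim (part (@complex.Re R) x @ F)
  +i* lim (part (@complex.Im R) x @ F).
have part_close (h : R[i] -> R) x (e : R) (f0 : B) :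
    (forall a b, `|h a - h b| <= complex.Re `|a - b|) ->
    F [set f | forall x, complex.Re `|val f0 x - val f x| <= e] ->
    cvg (part h x @ F) -> `|h (val f0 x) - lim (part h x @ F)| <= e.
  move=> hl Ff0 pc.
  have c1 : `|h (val f0 x) - part h x f| @[f --> F] -->
      `|h (val f0 x) - lim (part h x @ F)|.
    by apply: cvg_norm; apply: cvgB => //; exact: cvg_cst.
  apply: (cvgr_to_le c1); apply: filterS Ff0 => f ff.
  exact: le_trans (hl _ _) (ff x).
have close (e : R) (f0 : B) :
    F [set f | forall x, complex.Re `|val f0 x - val f x| <= e] ->
    forall x, complex.Re `|val f0 x - g x| <= e + e.
  move=> Ff0 x; apply: le_trans (Re_norm_le_add _) _; rewrite ReB ImB.
  apply: lerD; apply: part_close => // a b; rewrite -?ReB -?ImB.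
    exact: ler_norm_Re.
  exact: ler_norm_Im.
have gb : bnd g.
  have [f0 Ff0] := Fe 1 ltr01.
  have [M f0M] := set_mem (valP f0).
  exists (M + (1 + 1)) => x; rewrite -[g x](subKr (val f0 x)).
  apply: le_trans (Re_norm_triangle _ _) _; rewrite normrN.
  by apply: lerD => //; exact: close.
have gB : g \in supspace_pred bounded_functions by exact/mem_set.
pose G : B := exist _ g gB.
apply/cvg_ex; exists G; apply/cvgrPdist_le => e e0.
have eE : e = (complex.Re e)%:C by rewrite RRe_real// gtr0_real.
have Re0 : 0 < complex.Re e by rewrite -ltcR -eE.
(* Two thirds are spent by [close], one each for the real and imaginary parts, and the last third on
   passing from [f0] to [f]. *)
have [|f0 Ff0] := Fe (complex.Re e / 3); first by rewrite divr_gt0.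
apply: filterS (Ff0) => f ff; rewrite eE -[`|_|]Re_normK lecR.
apply: supspace_norm_le => [|x].
  exact: ltW.
rewrite [val _ x](_ : _ = - (val f0 x - g x) + (val f0 x - val f x)); last first.
  by rewrite opprB addrA subrK.
apply: le_trans (Re_norm_triangle _ _) _; rewrite normrN.
by have := lerD (close _ _ Ff0 x) (ff x); lra.
Qed.

HB.instance Definition _ :=
  Uniform_isComplete.Build B bounded_functions_complete.

Definition bounded_complete : completeNormedModType R[i] := B.
End BoundedFunctionSpace.

(** * A mean on the sphere of C^2 *)

Lemma cprim_root_exists (R : realType) (n : nat) : (0 < n)%N ->
  exists w : R[i], n.-primitive_root w.
Proof.
move=> n_gt0; pose p : {poly R[i]} := 'X^n - 1.
have [r Dp] := closed_field_poly_normal p.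
rewrite (monicP _) ?monicXnsubC // scale1r in Dp.
have rn1 : all n.-unity_root r by apply/allP => z; rewrite -root_prod_XsubC -Dp.
have sz_r : (n < (size r).+1)%N.
  by rewrite -(size_prod_XsubC r id) -Dp size_XnsubC.
have [|z] := hasP (has_prim_root n_gt0 rn1 _ sz_r); last by exists z.
by rewrite -separable_prod_XsubC -Dp separable_Xn_sub_1 // pnatr_eq0 -lt0n.
Qed.

Lemma unity_norm (R : realType) (n : nat) (w : R[i]) :
  (0 < n)%N -> w ^+ n = 1 -> w * w^*%C = 1.
Proof.
move=> n0 wn; suff w1 : `|w| = 1 by rewrite -sqr_normc w1 expr1n.
by apply/eqP; rewrite -(@pexpr_eq1 _ _ n)// -normrX wn normr1.
Qed.

(** Discrete orthogonality of characters: a geometric sum whose ratio [h] is an [n]-th root of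
    unity, distinct from 1 because [a] and [b] differ modulo [n]. *)
Lemma prim_root_sum (R : realType) (n a b : nat) (w : R[i]) :
  n.-primitive_root w -> (a < n)%N -> (b < n)%N -> a != b ->
  \sum_(i < n) (w ^+ i) ^+ a * ((w ^+ i)^*%C) ^+ b = 0.
Proof.
move=> wn an bn ab.
have n0 : (0 < n)%N by apply: leq_ltn_trans an.
have ww := unity_norm n0 (prim_expr_order wn).
pose h := w ^+ a * w^*%C ^+ b.
have h1 : h != 1.
  apply: contra ab => /eqP h1; rewrite -[a](modn_small an) -[b](modn_small bn).
  rewrite -(eq_prim_root_expr wn); apply/eqP.
  rewrite -[RHS]mul1r -h1 /h -mulrA -exprMn [_^*%C * _]mulrC.
  by rewrite ww expr1n mulr1.
have hn : h ^+ n = 1.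
  rewrite /h exprMn -!exprM !(mulnC _ n) !exprM (prim_expr_order wn).
  by rewrite -(rmorphXn (@conjc R)) (prim_expr_order wn) rmorph1 !expr1n mulr1.
rewrite (eq_bigr (fun i : 'I_n => h ^+ i)) => [|i _]; last first.
  by rewrite /h exprMn rmorphXn -!exprM mulnC [(b * i)%N]mulnC.
by apply: (@mulfI _ (h - 1)); rewrite ?subr_eq0// -subrX1 hn subrr mulr0.
Qed.

(** * Riemann sums of powers on the unit interval *)

Section RiemannSum.
Variable R : realType.

Lemma expr_diff_bounds (x y : R) (c : nat) : 0 <= x -> x <= y ->
  c.+1%:R * x ^+ c * (y - x) <= y ^+ c.+1 - x ^+ c.+1 <=
  c.+1%:R * y ^+ c * (y - x).
Proof.
move=> x0 xy; have y0 := le_trans x0 xy; rewrite subrXX.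
have cst (t : R) : c.+1%:R * t ^+ c = \sum_(i < c.+1) t ^+ (c - i) * t ^+ i.
  rewrite (eq_bigr (fun=> t ^+ c)) ?sumr_const ?card_ord ?mulr_natl// => i _.
  by rewrite -exprD subnK// -ltnS.
rewrite (cst x) (cst y) [_ * (y - x)]mulrC [X in _ <= _ <= X]mulrC.
have yx : 0 <= y - x by rewrite subr_ge0.
apply/andP; split.
  apply: ler_wpM2l; rewrite ?subr_ge0//; apply: ler_sum => i _.
  apply: ler_wpM2r; first exact: exprn_ge0.
  by apply: lerXn2r; rewrite ?nnegrE.
apply: ler_wpM2l; rewrite ?subr_ge0//; apply: ler_sum => i _.
apply: ler_wpM2l; first exact: exprn_ge0.
by apply: lerXn2r; rewrite ?nnegrE.
Qed.

(** The left sum of a nondecreasing function lies below the integral, and the right sum, larger by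
    at most one step, above it. The integral appears only as the telescoping sum of increments of
    [x ^+ c.+1]. *)
Lemma riemann_sum_bounds (c n : nat) :
  let S := n.+1%:R^-1 * \sum_(j < n.+1) (j%:R / n.+1%:R) ^+ c : R in
  c.+1%:R^-1 - n.+1%:R^-1 <= S <= c.+1%:R^-1.
Proof.
set N : R := n.+1%:R; move=> /=; set S := _ * _.
have N0 : 0 < N by rewrite ltr0n.
have C0 : (0 : R) < c.+1%:R by rewrite ltr0n.
pose x (j : nat) : R := j%:R / N.
have xS j : x j.+1 - x j = N^-1 by rewrite /x -mulrBl -natrB// subSnn mul1r.
have x0 j : 0 <= x j by rewrite divr_ge0 ?ler0n ?ltW.
have x01 : x n.+1 = 1 by rewrite /x divff ?lt0r_neq0.
have x00 : x 0%N = 0 by rewrite /x mul0r.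
have tel : \sum_(0 <= j < n.+1) (x j.+1 ^+ c.+1 - x j ^+ c.+1) = 1.
  by rewrite (telescope_sumr (fun j => x j ^+ c.+1))// x01 x00 expr1n expr0n subr0.
have xle j : x j <= x j.+1 by rewrite -subr_ge0 xS invr_ge0 ltW.
have B j : c.+1%:R * x j ^+ c * N^-1 <= x j.+1 ^+ c.+1 - x j ^+ c.+1 <=
    c.+1%:R * x j.+1 ^+ c * N^-1.
  by have := expr_diff_bounds c (x0 j) (xle j); rewrite xS.
have SE : S = N^-1 * \sum_(0 <= j < n.+1) x j ^+ c by rewrite big_mkord.
have S'E : N^-1 * \sum_(0 <= j < n.+1) x j.+1 ^+ c <= S + N^-1.
  rewrite SE -[X in _ + X]mulr1 -mulrDr.
  apply: ler_wpM2l; first by rewrite invr_ge0 ltW.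
  rewrite -lerBlDl -sumrB (telescope_sumr (fun j => x j ^+ c))// x01 x00 expr1n.
  by rewrite gerBl exprn_ge0.
apply/andP; split.
- rewrite lerBlDr; apply: le_trans S'E.
  rewrite -(ler_pM2l C0) divff ?lt0r_neq0// -[leLHS]tel.
  rewrite mulrA mulr_sumr; apply: ler_sum => j _.
  by have /andP[_] := B j; rewrite mulrAC.
- rewrite -(ler_pM2l C0) divff ?lt0r_neq0// -[leRHS]tel SE.
  rewrite mulrA mulr_sumr; apply: ler_sum => j _.
  by have /andP[+ _] := B j; rewrite mulrAC.
Qed.

Lemma riemann_sum_cvg (c : nat) :
  n.+1%:R^-1 * \sum_(j < n.+1) (j%:R / n.+1%:R) ^+ c @[n --> \oo] -->
  (c.+1%:R^-1 : R).
Proof.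
apply: (@squeeze_cvgr _ _ _ _ (fun n => c.+1%:R^-1 - n.+1%:R^-1)
  (fun=> c.+1%:R^-1)).
- by apply: nearW => n; exact: riemann_sum_bounds.
- rewrite -[X in _ --> X]subr0; apply: cvgB; first exact: cvg_cst.
  exact: cvg_harmonic.
- exact: cvg_cst.
Qed.

End RiemannSum.

Lemma sum_prod3 (R : comNzRingType) (A B C : finType)
    (f : A -> R) (g : B -> R) (h : C -> R) :
  \sum_(i : A * B * C) f i.1.1 * (g i.1.2 * h i.2) =
  (\sum_a f a) * ((\sum_b g b) * (\sum_c h c)).
Proof.
rewrite -(pair_bigA _ (fun p c => f p.1 * (g p.2 * h c))) /=.
rewrite -(pair_bigA _ (fun a b => \sum_c f a * (g b * h c))) /=.
rewrite mulr_suml; apply: eq_bigr => a _.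
rewrite mulr_suml mulr_sumr; apply: eq_bigr => b _.
by rewrite !mulr_sumr.
Qed.

Lemma conjcM (R : realType) (x y : R[i]) : (x * y)^*%C = x^*%C * y^*%C.
Proof. exact: rmorphM. Qed.

Lemma norm_sqrC (R : realType) (x : R[i]) :
  (complex.Re `|x| ^+ 2)%:C = x * x^*%C.
Proof.
by rewrite (rmorphXn (real_complex R)) -sqr_normc; congr (_ ^+ 2); exact: Re_normK.
Qed.

Section SphereMean.
Variable R : realType.
Local Notation S := (csphere R 2).

Definition scoord (i : 'I_2) (x : S) : R[i] := val x 0 i.

Lemma coord_sphere x :
  scoord 0 x * (scoord 0 x)^*%C + scoord 1 x * (scoord 1 x)^*%C = 1.
Proof.
case: x => z zS; rewrite /scoord /=; move/eqP: zS; rewrite /l2norm => zS.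
have s1 : \sum_i complex.Re `|z 0 i| ^+ 2 = 1.
  by rewrite -[LHS]sqr_sqrtr ?zS ?expr1n// sumr_ge0// => j _; rewrite sqr_ge0.
rewrite -(rmorph1 (real_complex R)) -s1 !big_ord_recl big_ord0 addr0.
rewrite [RHS](rmorphD (real_complex R)); congr (_ + _).
  exact/esym/norm_sqrC.
rewrite (_ : lift ord0 ord0 = 1); first exact/esym/norm_sqrC.
exact/val_inj.
Qed.

Lemma bnd_coord i : bnd (scoord i).
Proof. by exists 1 => x; apply: (@Re_ler R _ 1); exact: csphere_coord. Qed.

(** For the invariant probability on the sphere of C^2, [|z0|^2] is uniform on [[0, 1]] and the two
    phases are uniform and independent; the grid discretizes these coordinates. *)
Definition sphere_grid_row (n j : nat) (u v : R[i]) : 'rV[R[i]]_2 :=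
  \row_k (if k == 0 then (Num.sqrt (j%:R / n.+1%:R))%:C * u
          else (Num.sqrt (1 - j%:R / n.+1%:R))%:C * v).

Lemma sphere_grid_row_norm n (j : 'I_n.+1) (u v : R[i]) :
  u * u^*%C = 1 -> v * v^*%C = 1 -> l2norm (sphere_grid_row n j u v) == 1.
Proof.
move=> u1 v1; rewrite /l2norm !big_ord_recl big_ord0 addr0 !mxE /=.
have nu (r : R) w : w * w^*%C = 1 :> R[i] ->
    complex.Re `|(Num.sqrt r)%:C * w| ^+ 2 = Num.sqrt r ^+ 2.
  move=> w1; rewrite Re_normM exprMn (Re_norm_sqr w) w1 mulr1.
  by rewrite norm_real real_normK// num_real.
rewrite !nu// !sqr_sqrtr ?divr_ge0// ?subrKC ?sqrtr1//.
by rewrite subr_ge0 ler_pdivrMr ?ltr0n// mul1r ler_nat ltnW.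
Qed.

Definition grid_root n : R[i] := projT1 (cid (cprim_root_exists R (ltn0Sn n))).

Lemma grid_rootP n : n.+1.-primitive_root (grid_root n).
Proof. exact: (projT2 (cid (cprim_root_exists R (ltn0Sn n)))). Qed.

Lemma grid_rootX n i : grid_root n ^+ i * (grid_root n ^+ i)^*%C = 1.
Proof.
by rewrite rmorphXn -exprMn (unity_norm (ltn0Sn n)) ?expr1n//;
  exact: prim_expr_order (grid_rootP n).
Qed.

Definition grid_index n : finType := ('I_n.+1 * 'I_n.+1 * 'I_n.+1)%type.

Definition sphere_grid n (i : grid_index n) : S :=
  exist (fun z => l2norm z == 1) _ (sphere_grid_row_norm i.1.1 (grid_rootX n
    i.1.2) (grid_rootX n i.2)).

Lemma grid_index_gt0 n : (0 < #|grid_index n|)%N.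
Proof. by rewrite !card_prod !card_ord. Qed.

Definition sphere_mean : mean R S :=
  @umean R S grid_index sphere_grid grid_index_gt0.

Local Notation cj i x := ((scoord i x)^*%C).

Definition monom (a a' b b' : nat) (x : S) : R[i] :=
  scoord 0 x ^+ a * cj 0 x ^+ a' * (scoord 1 x ^+ b * cj 1 x ^+ b').

Lemma bnd_monom a a' b b' : bnd (monom a a' b b').
Proof.
by apply: bndM; apply: bndM; apply: bndX;
  do ?[apply: bnd_conj]; exact: bnd_coord.
Qed.

Lemma monom_grid n (i : grid_index n) a a' b b' :
  let t : R := i.1.1%:R / n.+1%:R in
  monom a a' b b' (sphere_grid i) =
  (Num.sqrt t ^+ (a + a') * Num.sqrt (1 - t) ^+ (b + b'))%:C *
  (((grid_root n ^+ i.1.2) ^+ a * (grid_root n ^+ i.1.2)^*%C ^+ a') *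
   ((grid_root n ^+ i.2) ^+ b * (grid_root n ^+ i.2)^*%C ^+ b')).
Proof.
move=> t; rewrite /monom /scoord !mxE /= !conjcM !conjc_real -/t.
rewrite (rmorphM (real_complex R)) !(rmorphXn (real_complex R)) /= !exprMn !exprD.
ring.
Qed.

(** No limit is computed: once the grid is finer than all exponents, one of the sums over phases
    vanishes exactly. *)
Lemma sphere_mean_offdiag a a' b b' : (a != a') || (b != b') ->
  sphere_mean (monom a a' b b') = 0.
Proof.
move=> ab; apply: ulimE.
all: apply: cvg_near_cst; near=> n.
all: rewrite /average (eq_bigr _ (fun i _ => monom_grid i a a' b b')).
all: rewrite (sum_prod3 (fun j : 'I_n.+1 => (Num.sqrt (j%:R / n.+1%:R) ^+ (a + a') *
    Num.sqrt (1 - j%:R / n.+1%:R) ^+ (b + b'))%:C)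
  (fun k : 'I_n.+1 => (grid_root n ^+ k) ^+ a * (grid_root n ^+ k)^*%C ^+ a')
  (fun k : 'I_n.+1 => (grid_root n ^+ k) ^+ b * (grid_root n ^+ k)^*%C ^+ b')).
all: suff -> :
   (\sum_(k < n.+1) (grid_root n ^+ k) ^+ a * (grid_root n ^+ k)^*%C ^+ a') *
   (\sum_(k < n.+1) (grid_root n ^+ k) ^+ b * (grid_root n ^+ k)^*%C ^+ b') = 0
  by rewrite !mulr0.
all: have /and4P[an an' bn bn'] :
  [&& (a < n.+1)%N, (a' < n.+1)%N, (b < n.+1)%N & (b' < n.+1)%N].
1,3: rewrite !ltnS -!geq_max; near: n; exact: nbhs_infty_ge.
all: case/orP: ab => ab.
all: rewrite (prim_root_sum (grid_rootP n) _ _ ab)// ?mul0r ?mulr0//.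
Unshelve. all: by end_near. Qed.

Lemma average_diag n c :
  average sphere_grid n (monom c c 0 0) =
  (n.+1%:R^-1 * \sum_(j < n.+1) (j%:R / n.+1%:R) ^+ c)%:C.
Proof.
rewrite /average (eq_bigr _ (fun i _ => monom_grid i c c 0 0)).
rewrite (sum_prod3 (fun j : 'I_n.+1 => (Num.sqrt (j%:R / n.+1%:R) ^+ (c + c) *
    Num.sqrt (1 - j%:R / n.+1%:R) ^+ (0 + 0))%:C)
  (fun k : 'I_n.+1 => (grid_root n ^+ k) ^+ c * (grid_root n ^+ k)^*%C ^+ c)
  (fun k : 'I_n.+1 => (grid_root n ^+ k) ^+ 0 * (grid_root n ^+ k)^*%C ^+ 0)).
rewrite !card_prod !card_ord.
rewrite [X in _ * (_ * (X * _))](eq_bigr (fun=> 1)) => [|k _]; last first.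
  by rewrite -exprMn grid_rootX expr1n.
rewrite [X in _ * (_ * (_ * X))](eq_bigr (fun=> 1)) => [|k _]; last first.
  by rewrite !expr0 mulr1.
rewrite [X in _ * (X * _)](eq_bigr (fun j : 'I_n.+1 => ((j%:R / n.+1%:R) ^+ c)%:C)).
  rewrite !sumr_const !card_ord -(rmorph_sum (real_complex R)).
  rewrite -!(rmorph_nat (real_complex R)) -!rmorphM; congr (_ %:C).
  rewrite !natrM !invfM; have N0 : (n.+1%:R : R) != 0 by rewrite pnatr_eq0.
  by rewrite [X in _ * X]mulrC mulrA -!mulrA; field.
move=> j _; rewrite expr0 mulr1 addnn -mul2n exprM sqr_sqrtr//.
Qed.

Lemma sphere_mean_diag0 c : sphere_mean (monom c c 0 0) = (c.+1%:R)^-1.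
Proof.
rewrite -(rmorph_nat (real_complex R)) -fmorphV; apply: ulimE.
  by under eq_fun do rewrite average_diag; exact: riemann_sum_cvg.
by under eq_fun do rewrite average_diag; exact: cvg_cst.
Qed.

(** A Beta integral. Replacing one factor [|z1|^2] by [1 - |z0|^2] gives the induction on [d], so
    only the moments of [|z0|^2] need a limit. *)
Lemma sphere_mean_diag c d :
  sphere_mean (monom c c d d) = c`!%:R * d`!%:R / (c + d).+1`!%:R.
Proof.
elim: d c => [|d IH] c.
  rewrite sphere_mean_diag0 fact0 mulr1 addn0 factS natrM invfM mulrCA divff ?mulr1//.
rewrite (_ : monom c c d.+1 d.+1 =
    fun x => monom c c d d x + (-1) * monom c.+1 c.+1 d d x); last first.
  apply/funext => x; rewrite /monom !exprS.
  have := coord_sphere x; set u := scoord 0 x; set v := scoord 1 x => uv.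
  have -> : v * v ^+ d * (v^*%C * v^*%C ^+ d) =
    (1 - u * u^*%C) * (v ^+ d * v^*%C ^+ d) by rewrite -uv; ring.
  by ring.
rewrite meanD ?meanZ ?IH; do ?[exact: bnd_monom | apply: bndM; [exact: bnd_cst|]].
have f0 k : (k`!%:R : R[i]) != 0 by rewrite pnatr_eq0 -lt0n fact_gt0.
rewrite addSn addnS (factS c) (factS d) (factS (c + d).+1).
rewrite (natrM _ c.+1) (natrM _ d.+1) (natrM _ (c + d).+2).
have n0 : ((c + d).+2%:R : R[i]) != 0 by rewrite pnatr_eq0.
have key (A B F x y : R[i]) : F != 0 -> x + y + 1 + 1 != 0 ->
    A * B / F + -1 * ((x + 1) * A * B / ((x + y + 1 + 1) * F)) =
    A * ((y + 1) * B) / ((x + y + 1 + 1) * F).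
  by move=> F0 xy0; field; rewrite F0 xy0.
have cdE : ((c + d).+2%:R : R[i]) = c%:R + d%:R + 1 + 1 by rewrite -!natr1 natrD.
rewrite -(natr1 c) -(natr1 d) cdE; apply: key => //.
Qed.

End SphereMean.

(** * Moments of zonal functions *)

Section ZonalMoments.
Variable R : realType.
Local Notation S := (csphere R 2).
Local Notation M := (@sphere_mean R).

Definition inner (z w : S) : R[i] :=
  scoord 0 z * (scoord 0 w)^*%C + scoord 1 z * (scoord 1 w)^*%C.

Lemma inner_conj z w : (inner z w)^*%C = inner w z.
Proof.
rewrite /inner (rmorphD (@conjc R)) /= !conjcM !conjcK; congr (_ + _); exact: mulrC.
Qed.

Lemma bnd_innerl w : bnd (inner ^~ w).
Proof. by apply: bndD; apply: bndM; do ?exact: bnd_coord; exact: bnd_cst. Qed.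

Lemma bnd_innerr w : bnd (inner w).
Proof.
apply: bndD; apply: bndM; do ?exact: bnd_cst.
all: by apply: bnd_conj; exact: bnd_coord.
Qed.

(** In [z], [inner w z] is antiholomorphic and [inner z w] holomorphic. The monomial factor keeps
    the family closed when a factor [inner z w] is expanded, which lowers [b] to 0. *)
Definition zonal_moment (w : S) (a b c c' d d' : nat) : R[i] :=
  M (fun z => inner w z ^+ a * (inner z w ^+ b * monom c c' d d' z)).

Lemma bnd_zonal w a b c c' d d' :
  bnd (fun z => inner w z ^+ a * (inner z w ^+ b * monom c c' d d' z)).
Proof.
apply: bndM; first by apply: bndX; exact: bnd_innerr.
by apply: bndM; [apply: bndX; exact: bnd_innerl|exact: bnd_monom].
Qed.

Lemma zonal_momentS w a b c c' d d' : zonal_moment w a b.+1 c c' d d' =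
  (scoord 0 w)^*%C * zonal_moment w a b c.+1 c' d d' +
  (scoord 1 w)^*%C * zonal_moment w a b c c' d.+1 d'.
Proof.
rewrite /zonal_moment -(meanZ M _ (bnd_zonal w a b c.+1 c' d d')).
rewrite -(meanZ M _ (bnd_zonal w a b c c' d.+1 d')) -meanD.
- congr (M _); apply/funext => z; rewrite /monom !exprS {2}/inner; ring.
- by apply: bndM; [exact: bnd_cst|exact: bnd_zonal].
- by apply: bndM; [exact: bnd_cst|exact: bnd_zonal].
Qed.

Lemma zonal_moment0 w a c c' d d' : zonal_moment w a 0 c c' d d' =
  \sum_(i < a.+1) 'C(a, i)%:R * (scoord 0 w ^+ (a - i) * scoord 1 w ^+ i) *
    M (monom c (a - i + c') d (i + d')).
Proof.
rewrite /zonal_moment.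
transitivity (M (fun z => \sum_(i < a.+1)
    'C(a, i)%:R * (scoord 0 w ^+ (a - i) * scoord 1 w ^+ i) *
    monom c (a - i + c') d (i + d') z)).
  congr (M _); apply/funext => z.
  rewrite expr0 mul1r /inner exprDn mulr_suml; apply: eq_bigr => i _.
  by rewrite /monom !exprMn !exprD -mulr_natl; ring.
rewrite mean_sum => [|i]; last by apply: bndM; [exact: bnd_cst|exact: bnd_monom].
by apply: eq_bigr => i _; rewrite meanZ//; exact: bnd_monom.
Qed.

Lemma zonal_moment0_single w a c c' d d' (k : 'I_a.+1) : (k + d')%N = d ->
  zonal_moment w a 0 c c' d d' =
  'C(a, k)%:R * (scoord 0 w ^+ (a - k) * scoord 1 w ^+ k) *
    M (monom c (a - k + c') d d).
Proof.
move=> kd; rewrite zonal_moment0 (bigD1 k)//= kd big1 ?addr0// => i ik.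
rewrite sphere_mean_offdiag ?mulr0//; apply/orP; right.
by rewrite -kd eqn_add2r eq_sym.
Qed.

Lemma zonal_moment0_vanish w a c c' d d' :
  (forall i : 'I_a.+1, (c != a - i + c')%N || (d != i + d')%N) ->
  zonal_moment w a 0 c c' d d' = 0.
Proof.
move=> h; rewrite zonal_moment0 big1// => i _.
by rewrite sphere_mean_offdiag ?mulr0.
Qed.

Lemma natr_fact_neq0 k : (k`!%:R : R[i]) != 0.
Proof. by rewrite pnatr_eq0 -lt0n fact_gt0. Qed.

Lemma natrS_neq0 k : (k.+1%:R : R[i]) != 0.
Proof. by rewrite pnatr_eq0. Qed.

Lemma natr_bin_fact c d :
  'C(c + d, d)%:R * (c`!%:R * d`!%:R) = (c + d)`!%:R :> R[i].
Proof.
rewrite -!natrM -(bin_fact (leq_addl c d)) addnK.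
by rewrite [(c`! * _)%N]mulnC.
Qed.

(** This is the reproducing property of [(a + 1) <w, z>^a] on holomorphic polynomials of degree [a],
    applied to [<z, w>^b z0^c z1^d], with [<w, w> = 1]. *)
Lemma zonal_moment_holo w a b c d : (b + c + d)%N = a ->
  zonal_moment w a b c 0 d 0 = scoord 0 w ^+ c * scoord 1 w ^+ d / a.+1%:R.
Proof.
elim: b c d => [|b IH] c d.
  rewrite add0n => <-; have dlt : (d < (c + d).+1)%N by rewrite ltnS leq_addl.
  rewrite (@zonal_moment0_single _ _ _ _ _ _ (Ordinal dlt)) ?addn0//= addnK.
  rewrite sphere_mean_diag [(c + d).+1`!]factS natrM -natr_bin_fact.
  have := natr_fact_neq0 (c + d); rewrite -natr_bin_fact !mulf_eq0 !negb_or.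
  move=> /and3P[b0 c0 d0].
  have key (N B C D x : R[i]) : N != 0 -> B != 0 -> C != 0 -> D != 0 ->
      B * x * (C * D / (N * (B * (C * D)))) = x / N.
    by move=> N0 B0 C0 D0; field; rewrite N0 B0 C0 D0.
  exact: key (natrS_neq0 _) b0 c0 d0.
move=> bcd; rewrite zonal_momentS !IH; [|by rewrite -bcd; ring..].
rewrite !exprS -[RHS]mulr1 -(coord_sphere w); ring.
Qed.

(** The right side is the derivative in [z0] of [G = <z, w>^b z0^c z1^d] at [w], over [(a+1)(a+2)]:
    what differentiating the reproducing formula of degree [a + 1] in [w0] yields. *)
Lemma zonal_moment_conj0 w a b c d : (b + c + d)%N = a.+1 ->
  zonal_moment w a b c 1 d 0 =
  (b%:R * (scoord 0 w)^*%C * (scoord 0 w ^+ c * scoord 1 w ^+ d) +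
   c%:R * (scoord 0 w ^+ c.-1 * scoord 1 w ^+ d)) / (a.+1%:R * a.+2%:R).
Proof.
elim: b c d => [|b IH] c d.
  rewrite add0n; case: c => [|c] cda.
    rewrite zonal_moment0_vanish ?mul0r ?addr0 ?mul0r// => i.
    by apply/orP; left; rewrite addn1.
  move: cda => [<-]; have dlt : (d < (c + d).+1)%N by rewrite ltnS leq_addl.
  rewrite (@zonal_moment0_single _ _ _ _ _ _ (Ordinal dlt)) ?addn0//= addnK addn1.
  rewrite sphere_mean_diag addSn (factS c) (factS (c + d).+1) (factS (c + d)).
  rewrite (natrM _ c.+1) (natrM _ (c + d).+2) (natrM _ (c + d).+1).
  rewrite -natr_bin_fact.
  have := natr_fact_neq0 (c + d); rewrite -natr_bin_fact !mulf_eq0 !negb_or.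
  move=> /and3P[b0 c0 d0].
  have key (N N' B C D K x z : R[i]) :
      N != 0 -> N' != 0 -> B != 0 -> C != 0 -> D != 0 ->
      B * x * (K * C * D / (N' * (N * (B * (C * D))))) =
      (0 * z + K * x) / (N * N').
    by move=> N0 N'0 B0 C0 D0; field; rewrite N0 N'0 B0 C0 D0.
  rewrite -[0%:R * _ * _]mulrA.
  exact: key (natrS_neq0 _) (natrS_neq0 _) b0 c0 d0.
move=> bcd; rewrite zonal_momentS !IH; [|by rewrite -bcd; ring..].
(* The factor [c%:R] absorbs the case [c = 0], where [c.-1] is 0 again. *)
have E : c%:R * scoord 0 w ^+ c = c%:R * (scoord 0 w * scoord 0 w ^+ c.-1) :> R[i].
  by case: c {bcd} => [|c]; rewrite ?mul0r// -exprS.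
have -> : c%:R * (scoord 0 w ^+ c.-1 * scoord 1 w ^+ d) =
  c%:R * (scoord 0 w * scoord 0 w ^+ c.-1) * scoord 1 w ^+ d * (scoord 0 w)^*%C +
  c%:R * scoord 0 w ^+ c.-1 * scoord 1 w ^+ d.+1 * (scoord 1 w)^*%C :> R[i].
  by rewrite exprS -[LHS]mulr1 -(coord_sphere w); ring.
have -> : b.+1%:R * (scoord 0 w)^*%C * (scoord 0 w ^+ c * scoord 1 w ^+ d) =
  (scoord 0 w)^*%C * (scoord 0 w ^+ c * scoord 1 w ^+ d) *
  (1 + b%:R * (scoord 0 w * (scoord 0 w)^*%C + scoord 1 w * (scoord 1 w)^*%C)).
  by rewrite coord_sphere -natr1; ring.
rewrite -E -!natr1 /= !exprS; ring.
Qed.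

Lemma zonal_moment_conj1 w a b c d : (b + c + d)%N = a.+1 ->
  zonal_moment w a b c 0 d 1 =
  (b%:R * (scoord 1 w)^*%C * (scoord 0 w ^+ c * scoord 1 w ^+ d) +
   d%:R * (scoord 0 w ^+ c * scoord 1 w ^+ d.-1)) / (a.+1%:R * a.+2%:R).
Proof.
elim: b c d => [|b IH] c d.
  rewrite add0n; case: d => [|d] cda.
    rewrite zonal_moment0_vanish ?mul0r ?addr0 ?mul0r// => i.
    by apply/orP; right; rewrite addn1.
  rewrite addnS in cda; move: cda => [<-].
  have dlt : (d < (c + d).+1)%N by rewrite ltnS leq_addl.
  rewrite (@zonal_moment0_single _ _ _ _ _ _ (Ordinal dlt)) ?addn1//= addnK addn0.
  rewrite sphere_mean_diag addnS (factS d) (factS (c + d).+1) (factS (c + d)).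
  rewrite (natrM _ d.+1) (natrM _ (c + d).+2) (natrM _ (c + d).+1).
  rewrite -natr_bin_fact.
  have := natr_fact_neq0 (c + d); rewrite -natr_bin_fact !mulf_eq0 !negb_or.
  move=> /and3P[b0 c0 d0].
  have key (N N' B C D K x z : R[i]) :
      N != 0 -> N' != 0 -> B != 0 -> C != 0 -> D != 0 ->
      B * x * (C * (K * D) / (N' * (N * (B * (C * D))))) =
      (0 * z + K * x) / (N * N').
    by move=> N0 N'0 B0 C0 D0; field; rewrite N0 N'0 B0 C0 D0.
  rewrite -[0%:R * _ * _]mulrA.
  exact: key (natrS_neq0 _) (natrS_neq0 _) b0 c0 d0.
move=> bcd; rewrite zonal_momentS !IH; [|by rewrite -bcd; ring..].
have E : d%:R * scoord 1 w ^+ d = d%:R * (scoord 1 w * scoord 1 w ^+ d.-1) :> R[i].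
  by case: d {bcd} => [|d]; rewrite ?mul0r// -exprS.
have -> : d%:R * (scoord 0 w ^+ c * scoord 1 w ^+ d.-1) =
  d%:R * (scoord 1 w * scoord 1 w ^+ d.-1) * scoord 0 w ^+ c * (scoord 1 w)^*%C +
  d%:R * scoord 1 w ^+ d.-1 * scoord 0 w ^+ c.+1 * (scoord 0 w)^*%C :> R[i].
  by rewrite exprS -[LHS]mulr1 -(coord_sphere w); ring.
have -> : b.+1%:R * (scoord 1 w)^*%C * (scoord 0 w ^+ c * scoord 1 w ^+ d) =
  (scoord 1 w)^*%C * (scoord 0 w ^+ c * scoord 1 w ^+ d) *
  (1 + b%:R * (scoord 0 w * (scoord 0 w)^*%C + scoord 1 w * (scoord 1 w)^*%C)).
  by rewrite coord_sphere -natr1; ring.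
rewrite -E -!natr1 /= !exprS; ring.
Qed.

End ZonalMoments.

(** * The Laplacian on polynomials of bidegree (q.+1, 1) *)

Lemma wirtinger_mulB (K : comNzRingType) (f f1 f2 g g1 g2 i u : K) :
  (f1 * g + f * g1 - i * (f2 * g + f * g2)) * u =
  (f1 - i * f2) * u * g + f * ((g1 - i * g2) * u).
Proof. ring. Qed.

Lemma wirtinger_mulD (K : comNzRingType) (f f1 f2 g g1 g2 i u : K) :
  (f1 * g + f * g1 + i * (f2 * g + f * g2)) * u =
  (f1 + i * f2) * u * g + f * ((g1 + i * g2) * u).
Proof. ring. Qed.

Section Wirtinger.
Variables (R : realType) (n : nat).
Local Notation V := 'rV[R[i]]_n.
Implicit Types f g : V -> R[i].

Lemma rderiveM f g v z : rpoly f -> rpoly g ->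
  rderive (fun z => f z * g z) v z = rderive f v z * g z + f z * rderive g v z.
Proof.
by move=> fp gp; apply: has_rderiveE; apply: has_rderiveM;
  exact: has_rderive_rpoly.
Qed.

(** [rpoly] is carried along because the product rule for [rderive] requires it. *)
Definition has_wirtinger j f (g h : V -> R[i]) :=
  [/\ rpoly f, forall z, dz j f z = g z & forall z, dzbar j f z = h z].

Lemma has_wirtingerM j f g f1 f2 g1 g2 :
  has_wirtinger j f f1 f2 -> has_wirtinger j g g1 g2 ->
  has_wirtinger j (fun z => f z * g z) (fun z => f1 z * g z + f z * g1 z)
    (fun z => f2 z * g z + f z * g2 z).
Proof.
move=> [fp fz fb] [gp gz gb]; split; first exact: rpoly_mul.
  by move=> z; rewrite -fz -gz /dz !rderiveM//; exact: wirtinger_mulB.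
by move=> z; rewrite -fb -gb /dzbar !rderiveM//; exact: wirtinger_mulD.
Qed.

Lemma has_wirtinger_cst j c : has_wirtinger j (fun=> c) (fun=> 0) (fun=> 0).
Proof.
by split; [exact: rpoly_cst|..] => z;
  rewrite /dz /dzbar !(has_rderiveE (has_rderive_cst _ _ _)) mulr0 ?subr0
    ?addr0 mul0r.
Qed.

Lemma sqr_imaginary : ('i%C : R[i]) * 'i%C = -1.
Proof. by rewrite -expr2 sqr_i. Qed.

Lemma has_wirtinger_coord j k : has_wirtinger j (fun z => z 0 k)
  (fun=> (k == j)%:R) (fun=> 0).
Proof.
split; first exact: rpoly_coord.
  move=> z; rewrite /dz !(has_rderiveE (has_rderive_coord _ _ _)) !mxE eqxx /=.
  by rewrite mulrA sqr_imaginary mulN1r opprK -[_ + _]mulr2n -[_ *+ 2]mulr_natr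
    mulfK ?pnatr_eq0.
move=> z; rewrite /dzbar !(has_rderiveE (has_rderive_coord _ _ _)) !mxE eqxx /=.
by rewrite mulrA sqr_imaginary mulN1r subrr mul0r.
Qed.

Lemma has_wirtinger_conj j k : has_wirtinger j (fun z => (z 0 k)^*%C)
  (fun=> 0) (fun=> (k == j)%:R).
Proof.
have i_conj : ('i%C : R[i])^*%C = - 'i%C by apply: ReIm_inj; rewrite /= ?oppr0.
split; first exact: rpoly_conj.
  move=> z; rewrite /dz !(has_rderiveE (has_rderive_conj _ _ _)) !mxE eqxx /=.
  by rewrite conjcM i_conj conjc_nat mulrA mulrN sqr_imaginary opprK mul1r
    subrr mul0r.
move=> z; rewrite /dzbar !(has_rderiveE (has_rderive_conj _ _ _)) !mxE eqxx /=.
by rewrite conjcM i_conj conjc_nat mulrA mulrN sqr_imaginary opprK mul1r -[_ +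
  _]mulr2n -[_ *+ 2]mulr_natr mulfK ?pnatr_eq0.
Qed.

Lemma has_wirtingerX j f f1 f2 k : has_wirtinger j f f1 f2 ->
  has_wirtinger j (fun z => f z ^+ k) (fun z => k%:R * f z ^+ k.-1 * f1 z)
    (fun z => k%:R * f z ^+ k.-1 * f2 z).
Proof.
move=> fw; elim: k => [|k [kp kz kb]].
  have [cp cz cb] := has_wirtinger_cst j 1.
  by split=> // z; rewrite ?cz ?cb !mul0r.
have E (x : R[i]) : k%:R * x ^+ k.-1 * x = k%:R * x ^+ k.
  by case: k {kp kz kb} => [|k]; rewrite ?mul0r// -mulrA -exprSr.
rewrite (_ : (fun z => f z ^+ k.+1) = fun z => f z ^+ k * f z); last first.
  by apply/funext => z; rewrite exprSr.
have [] := has_wirtingerM (And3 kp kz kb) fw.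
move=> p z b; split => // x; rewrite ?z ?b /= -natr1 mulrAC E; ring.
Qed.

End Wirtinger.

Lemma zonal_lin (K : comNzRingType) (b f g f' g' l u : K) :
  (b * (l * f + g) + (l * f' + g')) * u =
  l * ((b * f + f') * u) + (b * g + g') * u.
Proof. ring. Qed.

Lemma zonal_lin2 (K : comNzRingType) (u v l f g : K) :
  u * (v * (l * f + g)) = l * (u * (v * f)) + u * (v * g).
Proof. ring. Qed.

Section BihomogeneousPlane.
Variable R : realType.
Local Notation V := 'rV[R[i]]_2.

Definition plane_monom (a a' b b' : nat) (z : V) : R[i] :=
  z 0 0 ^+ a * (z 0 0)^*%C ^+ a' * (z 0 1 ^+ b * (z 0 1)^*%C ^+ b').

Lemma ord2_lift : lift ord0 ord0 = 1 :> 'I_2. Proof. exact/val_inj. Qed.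

Lemma bimonom_plane (a b : 'I_2 -> nat) (z : V) :
  bimonom a b z = plane_monom (a 0) (b 0) (a 1) (b 1) z.
Proof. by rewrite /bimonom !big_ord_recl big_ord0 mulr1 ord2_lift. Qed.

Lemma bihomog_monom a a' b b' :
  bihomog (a + b) (a' + b') (plane_monom a a' b b').
Proof.
pose ix k l : {ffun 'I_2 -> 'I_(k + l).+1} :=
  [ffun i => inord (if i == 0 then k else l)].
have ix0 k l : ix k l 0 = k :> nat by rewrite ffunE inordK// ltnS leq_addr.
have ix1 k l : ix k l 1 = l :> nat by rewrite ffunE inordK// ltnS leq_addl.
have ixs k l : (\sum_i ix k l i == k + l)%N.
  by rewrite !big_ord_recl big_ord0 ord2_lift ix0 ix1 addn0.
exists (fun c d => ((c == ix a b) && (d == ix a' b'))%:R) => z.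
rewrite (bigD1 (ix a b))//= (bigD1 (ix a' b'))//= !eqxx mul1r.
rewrite bimonom_plane !ix0 !ix1 big1 => [|d /andP[_ /negbTE ->]];
  last by rewrite mul0r.
rewrite addr0 big1 ?addr0// => c /andP[_ /negbTE ->].
by rewrite big1// => d _; rewrite mul0r.
Qed.

(** Antiholomorphic degree one leaves two kinds of spanning monomials, with a single factor
    [conj z0] or [conj z1]. *)
Lemma bihomog_lin_ind p (Pr : (V -> R[i]) -> Prop) :
  Pr (fun=> 0) ->
  (forall l f g, Pr f -> Pr g -> Pr (fun z => l * f z + g z)) ->
  (forall c d, (c + d)%N = p -> Pr (plane_monom c 1 d 0)) ->
  (forall c d, (c + d)%N = p -> Pr (plane_monom c 0 d 1)) ->
  forall f, bihomog p 1 f -> Pr f.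
Proof.
move=> P0 Plin Pm0 Pm1 f [c /funext ->].
have Psum (I : Type) (r : seq I) (Q : pred I) (F : I -> V -> R[i]) :
    (forall i, Q i -> Pr (F i)) -> Pr (fun z => \sum_(i <- r | Q i) F i z).
  move=> QF; elim: r => [|i r IH]; first by under eq_fun do rewrite big_nil.
  under eq_fun do rewrite big_cons; case: (boolP (Q i)) => // Qi.
  by under eq_fun do rewrite -[F i _]mul1r; apply: Plin => //; exact: QF.
apply: (Psum _ _) => a /eqP; rewrite !big_ord_recl big_ord0 ord2_lift addn0 => ap.
apply: (Psum _ _) => b /eqP; rewrite !big_ord_recl big_ord0 ord2_lift addn0 => bp.
rewrite (_ : (fun z => _) = fun z => c a b *
    plane_monom (a 0) (b 0) (a 1) (b 1) z + 0); last first.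
  by apply/funext => z; rewrite bimonom_plane addr0.
apply: Plin => //; move: bp; case: (nat_of_ord (b 0)) (nat_of_ord (b 1)) =>
  [|[|//]] [|[|//]]//= _.
  exact: Pm1.
exact: Pm0.
Qed.

Lemma laplacian_plane (f : V -> R[i]) z :
  laplacian f z = dz 0 (dzbar 0 f) z + dz 1 (dzbar 1 f) z.
Proof.
rewrite /laplacian (big_ord_recl 1); congr (_ + _).
by rewrite big_ord1; congr (dz _ (dzbar _ f) z); exact/val_inj.
Qed.

Lemma laplacian0 (z : V) : laplacian (fun=> 0) z = 0.
Proof.
have := laplacian_lin (-1) z (rpoly_cst 2 0) (rpoly_cst 2 0).
by rewrite !(mulN1r, addNr).
Qed.

Lemma laplacian_monom0 c d (z : V) :
  laplacian (plane_monom c 1 d 0) z = c%:R * plane_monom c.-1 0 d 0 z.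
Proof.
rewrite laplacian_plane.
have w0 j (k : 'I_2) m := has_wirtingerX m (has_wirtinger_coord R j k).
have w1 j (k : 'I_2) m := has_wirtingerX m (has_wirtinger_conj R j k).
have wm j c1 d1 c2 d2 : has_wirtinger j (plane_monom c1 c2 d1 d2) _ _ :=
  has_wirtingerM (has_wirtingerM (w0 j 0 c1) (w1 j 0 c2))
    (has_wirtingerM (w0 j 1 d1) (w1 j 1 d2)).
have [_ _ b0] := wm 0 c d 1%N 0%N.
have [_ _ b1] := wm 1 c d 1%N 0%N.
have -> : dzbar 0 (plane_monom c 1 d 0) = plane_monom c 0 d 0.
  by apply/funext => x; rewrite b0 /plane_monom /=; ring.
have -> : dzbar 1 (plane_monom c 1 d 0) = fun=> 0.
  by apply/funext => x; rewrite b1 /=; ring.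
have [_ z0 _] := wm 0 c d 0%N 0%N.
have [_ z1 _] := has_wirtinger_cst (1 : 'I_2) (0 : R[i]).
by rewrite z0 z1 /plane_monom /=; ring.
Qed.

Lemma laplacian_monom1 c d (z : V) :
  laplacian (plane_monom c 0 d 1) z = d%:R * plane_monom c 0 d.-1 0 z.
Proof.
rewrite laplacian_plane.
have w0 j (k : 'I_2) m := has_wirtingerX m (has_wirtinger_coord R j k).
have w1 j (k : 'I_2) m := has_wirtingerX m (has_wirtinger_conj R j k).
have wm j c1 d1 c2 d2 : has_wirtinger j (plane_monom c1 c2 d1 d2) _ _ :=
  has_wirtingerM (has_wirtingerM (w0 j 0 c1) (w1 j 0 c2))
    (has_wirtingerM (w0 j 1 d1) (w1 j 1 d2)).
have [_ _ b0] := wm 0 c d 0%N 1%N.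
have [_ _ b1] := wm 1 c d 0%N 1%N.
have -> : dzbar 1 (plane_monom c 0 d 1) = plane_monom c 0 d 0.
  by apply/funext => x; rewrite b1 /plane_monom /=; ring.
have -> : dzbar 0 (plane_monom c 0 d 1) = fun=> 0.
  by apply/funext => x; rewrite b0 /=; ring.
have [_ z0 _] := wm 1 c d 0%N 0%N.
have [_ z1 _] := has_wirtinger_cst (0 : 'I_2) (0 : R[i]).
by rewrite z0 z1 /plane_monom /=; ring.
Qed.

Lemma bnd_rpoly (f : V -> R[i]) : rpoly f -> bnd (fun z : csphere R 2 => f (val z)).
Proof.
elim=> [c|i|i|{}f g _ fb _ gb|{}f g _ fb _ gb].
- exact: bnd_cst.
- exact: bnd_coord.
- by apply: bnd_conj; exact: bnd_coord.
- exact: bndD.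
- exact: bndM.
Qed.

(* On the sphere the Laplacian, of bidegree [(q, 0)], may be multiplied by
   [|z|^2 = 1], which restores the bidegree [(q.+1, 1)]. *)
Lemma bihomog_laplacian q (f : V -> R[i]) : bihomog q.+1 1 f ->
  exists2 g, bihomog q.+1 1 g &
    forall w : csphere R 2, laplacian f (val w) = g (val w).
Proof.
(* The claim is strengthened by [rpoly f], which [laplacian_lin] requires in the linear step of the
   induction. *)
move=> fb; suff [] : rpoly f /\ exists2 g, bihomog q.+1 1 g &
  forall w : csphere R 2, laplacian f (val w) = g (val w) by [].
have lift_deg c d : (c + d)%N = q -> exists2 g : V -> R[i], bihomog q.+1 1 g &
    forall w : csphere R 2, plane_monom c 0 d 0 (val w) = g (val w).
  move=> cd; exists (fun z => 1 * plane_monom c.+1 1 d 0 z + plane_monom c 0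
    d.+1 1 z).
    apply: bihomogDZ; rewrite -cd.
      exact: (bihomog_monom c.+1 1 d 0).
    by rewrite -addnS; exact: (bihomog_monom c 0 d.+1 1).
  move=> w; rewrite -[LHS]mulr1 -[X in _ * X = _](coord_sphere w).
  by rewrite /plane_monom /scoord !exprS !expr0; ring.
have bscale l g : bihomog q.+1 1 g -> bihomog q.+1 1 (fun z : V => l * g z).
  move=> gb; under eq_fun do rewrite -[_ * _]addr0.
  by apply: bihomogDZ => //; exact: bihomog0.
move: f fb; apply: bihomog_lin_ind => [|l f g [fp [f' f'b ff']] [gp [g' g'b
  gg']]|c d cd|c d cd].
- split; first exact: (rpoly_cst 2 0).
  exists (fun=> 0) => [|w]; first exact: bihomog0.
  exact: laplacian0.
- split; first by apply: rpoly_add => //; exact: rpoly_scale.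
  exists (fun z => l * f' z + g' z) => [|w]; first exact: bihomogDZ.
  by rewrite laplacian_lin// ff' gg'.
- split; first exact: (bihomog_rpoly (bihomog_monom c 1 d 0)).
  case: c cd => [|c] cd.
    exists (fun=> 0) => [|w]; first exact: bihomog0.
    by rewrite laplacian_monom0 mul0r.
  have [|g gb gE] := lift_deg c d; first by move: cd => [].
  exists (fun z => c.+1%:R * g z) => [|w]; first exact: bscale.
  by rewrite laplacian_monom0 gE.
- split; first exact: (bihomog_rpoly (bihomog_monom c 0 d 1)).
  case: d cd => [|d] cd.
    exists (fun=> 0) => [|w]; first exact: bihomog0.
    by rewrite laplacian_monom1 mul0r.
  have [|g gb gE] := lift_deg c d; first by move: cd; rewrite addnS => -[].
  exists (fun z => d.+1%:R * g z) => [|w]; first exact: bscale.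
  by rewrite laplacian_monom1 gE.
Qed.

(** By linearity [f = conj z_i * g] with [g] a holomorphic monomial of degree [q.+1]. The moment is
    then the [i]-th derivative of [<z, w>^b g] at [w], up to the denominator: the power contributes
    [b * f], and the derivative of [g] is the Laplacian of [f]. *)
Lemma zonal_laplacian q b (f : V -> R[i]) (w : csphere R 2) : bihomog q.+1 1 f ->
  sphere_mean R (fun z => inner w z ^+ (q + b) * (inner z w ^+ b * f (val z))) =
  (b%:R * f (val w) + laplacian f (val w)) / ((q + b).+1%:R * (q + b).+2%:R).
Proof.
move=> fb; suff [] : rpoly f /\
    sphere_mean R (fun z => inner w z ^+ (q + b) * (inner z w ^+ b * f (val z))) =
    (b%:R * f (val w) + laplacian f (val w)) / ((q + b).+1%:R * (q + b).+2%:R) by [].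
have zb (g : V -> R[i]) : rpoly g ->
    bnd (fun z => inner w z ^+ (q + b) * (inner z w ^+ b * g (val z))).
  move=> gp; apply: bndM; first by apply: bndX; exact: bnd_innerr.
  by apply: bndM; [apply: bndX; exact: bnd_innerl|exact: bnd_rpoly].
move: f fb; apply: bihomog_lin_ind => [|l f g [fp fE] [gp gE]|c d cd|c d cd].
- split; first exact: (rpoly_cst 2 0).
  under eq_fun do rewrite !mulr0.
  by rewrite mean_cst laplacian0 mulr0 addr0 mul0r.
- split; first by apply: rpoly_add => //; exact: rpoly_scale.
  rewrite laplacian_lin//.
  under eq_fun do rewrite zonal_lin2.
  rewrite meanD ?meanZ; do ?exact: zb.
    by rewrite fE gE; exact/esym/zonal_lin.
  by apply: bndM; [exact: bnd_cst|exact: zb].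
- split; first exact: (bihomog_rpoly (bihomog_monom c 1 d 0)).
  have := @zonal_moment_conj0 R w (q + b) b c d; rewrite -addnA cd addnS addnC.
  move=> /(_ erefl); rewrite laplacian_monom0 => E; apply: (etrans E).
  by rewrite /plane_monom /scoord; ring.
- split; first exact: (bihomog_rpoly (bihomog_monom c 0 d 1)).
  have := @zonal_moment_conj1 R w (q + b) b c d; rewrite -addnA cd addnS addnC.
  move=> /(_ erefl); rewrite laplacian_monom1 => E; apply: (etrans E).
  by rewrite /plane_monom /scoord; ring.
Qed.

End BihomogeneousPlane.

(** * Projection constants of reproducing kernel spaces *)

Lemma supspace_bnd (R : realType) (T : Type) (X : supspace R T) (f : X) : bnd (val f).
Proof. by have [B] := supspace_bounded (set_mem (valP f)); exists B. Qed.

Section ReproducingKernel.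
Variables (R : realType) (T : Type) (M : mean R T) (X : supspace R T).
Variable k : T -> T -> R[i].
Variables (I : finType) (e c : I -> T -> R[i]).
Hypothesis e_in : forall i, supspace_set X (e i).
Hypothesis c_bnd : forall i, bnd (c i).
Hypothesis k_dec : forall z x, k z x = \sum_i e i z * c i x.
Hypothesis k_rep : forall f, supspace_set X f ->
  forall z, M (fun x => k z x * f x) = f z.

Let E i : X := exist (fun f => f \in supspace_pred X) (e i) (mem_set (e_in i)).

Lemma bnd_kernel z : bnd (k z).
Proof.
rewrite (_ : k z = fun x => \sum_i e i z * c i x); last first.
  by apply/funext => x; rewrite k_dec.
by apply: bnd_sum => i; apply: bndM => //; exact: bnd_cst.
Qed.

Lemma val_supspace_sum (Z : supspace R T) (J : finType) (l : J -> R[i])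
    (F : J -> Z) z :
  val (\sum_i l i *: F i) z = \sum_i l i * val (F i) z.
Proof.
pose A (f : Z) := val f z.
have AD f g : A (f + g) = A f + A g by [].
by rewrite -/(A _) (big_morph A AD erefl).
Qed.

Lemma kernel_expansion (f : T -> R[i]) z : bnd f ->
  val (\sum_i M (fun x => c i x * f x) *: E i) z = M (fun x => k z x * f x).
Proof.
move=> fb; rewrite val_supspace_sum.
under [in RHS]eq_fun do rewrite k_dec mulr_suml.
rewrite mean_sum => [|i]; last first.
  by apply: bndM => //; apply: bndM => //; exact: bnd_cst.
apply: eq_bigr => i _; rewrite /E /= mulrC -meanZ; last exact: bndM.
by congr (M _); apply/funext => x; rewrite mulrA.
Qed.

Lemma proj_const_le (C : R) : 0 <= C ->
  (forall z, complex.Re (M (fun x => `|k z x|)) <= C) ->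
  (proj_const X <= C%:E)%E.
Proof.
move=> C0 kC; apply: ge_ereal_sup => _ [Y [inj [Iiso ->]]].
have phi_ex x : exists phi : Y -> R[i],
    [/\ forall a y y', phi (a *: y + y') = a * phi y + phi y',
        forall f : X, phi (inj f) = val f x &
        forall y, complex.Re `|phi y| <= complex.Re `|y|].
  apply: complex_hahn_banach => // f; rewrite Iiso; exact: supspace_norm_ub.
have [phi phiP] := choice phi_ex.
have phib y : bnd (phi ^~ y).
  by exists (complex.Re `|y|) => x; have [_ _] := phiP x; apply.
(* The finite expansion of [k] is what places the averaged function in [X]; its values are given by
   [kernel_expansion]. *)
pose q y : X := \sum_i M (fun x => c i x * phi x y) *: E i.
pose Q y : Y := inj (q y).
have Qlin : linear Q.
  move=> a y y'; rewrite /Q -linearP; congr (inj _).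
  apply/val_inj/funext => z; rewrite [RHS](_ : _ = a * val (q y) z + val (q y') z)//.
  rewrite !kernel_expansion// -meanZ; last by apply: bndM => //; exact: bnd_kernel.
  rewrite -meanD; last 2 first.
  - by apply: bndM; [exact: bnd_cst|apply: bndM => //; exact: bnd_kernel].
  - by apply: bndM => //; exact: bnd_kernel.
  congr (M _); apply/funext => x; have [-> _ _] := phiP x; ring.
pose L : {linear Y -> Y} := HB.pack Q (GRing.isLinear.Build _ _ _ _ Q Qlin).
have LI f : L (inj f) = inj f.
  rewrite /= /Q; congr (inj _); apply/val_inj/funext => z.
  rewrite kernel_expansion// -[RHS](k_rep (set_mem (valP f))).
  by congr (M _); apply/funext => x; have [_ -> _] := phiP x.
have Lnorm : (opnorm L <= C%:E)%E.
  apply: ge_ereal_sup => _ [y /= y1 <-]; rewrite lee_fin /Q Iiso.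
  apply: supspace_norm_le => // z; rewrite kernel_expansion//.
  have kb := bnd_kernel z.
  apply: le_trans (mean_norm _ _) _; first exact: bndM.
  apply: le_trans (kC z); apply: mean_mono => [||x].
  - by apply: bnd_norm; exact: bndM.
  - exact: bnd_norm.
  apply: Re_ler; rewrite normrM ler_piMr// -[leLHS]Re_normK.
  have [_ _ /(_ y) py] := phiP x; apply: le_trans y1.
  by rewrite -[leRHS]Re_normK lecR.
apply: le_trans (Lnorm); apply: ereal_inf_lbound; exists L => //; split.
- exact: le_lt_trans Lnorm (ltry _).
- apply/seteqP; split => [_ [y _ <-]|_ [f _ <-]]; first by exists (q y).
  by exists (inj f).
- by move=> _ [f _ <-].
Qed.

(** * Lower bound by trace duality *)

Section LowerBound.
Variables (J : finType) (a b : J -> T -> R[i]).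
Hypothesis a_bnd : forall i, bnd (a i).
Hypothesis b_bnd : forall i, bnd (b i).
Let h z w := \sum_i a i z * b i w.
Hypothesis h_le1 : forall z w, complex.Re `|h z w| <= 1.
Hypothesis h_stable : forall f, supspace_set X f ->
  supspace_set X (fun w => M (fun z => h z w * f z)).

Let Y := bounded_complete R T.

Definition supspace_incl (f : X) : Y :=
  exist (fun f => f \in supspace_pred (bounded_functions R T)) (val f)
    (mem_set (supspace_bnd f)).

Lemma supspace_incl_linear : linear supspace_incl.
Proof. by move=> l f g; exact/val_inj. Qed.

HB.instance Definition _ :=
  GRing.isLinear.Build R[i] X Y _ supspace_incl supspace_incl_linear.

Let B i : Y := exist (fun f => f \in supspace_pred (bounded_functions R T)) (b i)
  (mem_set (b_bnd i)).

(* Averaging [P h_z] at [z] is the trace duality pairing of [P] with [h]; since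
   [h] maps [X] into itself, it only depends on the restriction of [P] to [X]. *)
Lemma projection_pairing (P : {linear Y -> Y}) :
  bounded_projection (range supspace_incl) P ->
  M (fun z => val (P (\sum_i a i z *: B i)) z) =
  M (fun x => M (fun z => h z x * k z x)).
Proof.
move=> [_ Prange PX].
have PB i : exists2 f, supspace_set X f & val (P (B i)) = f.
  have : range P (P (B i)) by exists (B i).
  by rewrite Prange => -[f _ <-]; exists (val f) => //; exact: (set_mem (valP f)).
have Pb i : bnd (val (P (B i))) by exact: supspace_bnd.
have e_bnd i : bnd (e i) by exact: (supspace_bnd (E i)).
(* [P (B i)] lies in [X], so the kernel reproduces it and expands it along the [e j]. *)
have PBE i z : val (P (B i)) z = \sum_j e j z * M (fun x => c j x * val (P (B i)) x).
  have [f Xf fE] := PB i; rewrite fE -[LHS](k_rep Xf) -kernel_expansion -?fE//.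
  by rewrite val_supspace_sum; apply: eq_bigr => j _; exact: mulrC.
transitivity (M (fun z => \sum_i \sum_j a i z * e j z *
    M (fun x => c j x * val (P (B i)) x))).
  congr (M _); apply/funext => z; rewrite linear_sum.
  rewrite (eq_bigr (fun i => a i z *: P (B i))) => [|i _]; last by rewrite linearZ.
  rewrite val_supspace_sum; apply: eq_bigr => i _; rewrite PBE mulr_sumr.
  by apply: eq_bigr => j _; rewrite mulrA.
have aeb i j : bnd (fun z => a i z * e j z) by exact: bndM.
rewrite mean_sum => [|i]; last first.
  by apply: bnd_sum => j; apply: bndM => //; exact: bnd_cst.
transitivity (\sum_i \sum_j M (fun z => a i z * e j z) *
    M (fun x => c j x * val (P (B i)) x)).
  apply: eq_bigr => i _; rewrite mean_sum => [|j]; last first.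
    by apply: bndM => //; exact: bnd_cst.
  by apply: eq_bigr => j _; rewrite meanZr.
rewrite exchange_big /=.
have ThE j w : M (fun z => h z w * e j z) = \sum_i M (fun z => a i z * e j z) * b i w.
  rewrite /h; under eq_fun do rewrite mulr_suml.
  rewrite mean_sum => [|i]; last by apply: bndM => //; apply: bndM => //;
    exact: bnd_cst.
  apply: eq_bigr => i _; rewrite -meanZr//; congr (M _); apply/funext => z.
  by rewrite mulrAC.
(* Here [P] disappears: [h_stable] puts the image of [e j] under the operator with kernel [h] in
   [X], where [P] is the identity. *)
have PT j w : \sum_i M (fun z => a i z * e j z) * val (P (B i)) w =
    M (fun z => h z w * e j z).
  rewrite -val_supspace_sum.
  rewrite (eq_bigr (fun i => P (M (fun z => a i z * e j z) *: B i))); last first.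
    by move=> i _; rewrite linearZ.
  rewrite -linear_sum PX.
    by rewrite val_supspace_sum ThE.
  exists (exist (fun f => f \in supspace_pred X) _ (mem_set (h_stable (e_in
    j)))) => //.
  apply/val_inj/funext => x; rewrite val_supspace_sum /= ThE.
  by apply: eq_bigr.
transitivity (\sum_j M (fun x => c j x * M (fun z => h z x * e j z))).
  apply: eq_bigr => j _.
  under [in RHS]eq_fun do rewrite -PT mulr_sumr.
  rewrite mean_sum => [|i]; last by apply: bndM => //; apply: bndM => //;
    exact: bnd_cst.
  apply: eq_bigr => i _; rewrite -meanZ; last by apply: bndM;
    [exact: c_bnd|exact: Pb].
  by congr (M _); apply/funext => x; rewrite mulrCA.
have hb x : bnd (h ^~ x).
  by apply: bnd_sum => i; apply: bndM => //; exact: bnd_cst.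
rewrite -mean_sum => [|j]; last first.
  by apply: bndM => //; apply: (@supspace_bnd _ _ X
    (exist (fun f => f \in supspace_pred X) _ (mem_set (h_stable (e_in j))))).
congr (M _); apply/funext => x.
under [in RHS]eq_fun do rewrite k_dec mulr_sumr.
rewrite mean_sum => [|j]; last first.
  by apply: bndM => //; apply: bndM => //; exact: bnd_cst.
apply: eq_bigr => j _; rewrite -meanZ; last exact: bndM.
by congr (M _); apply/funext => z; ring.
Qed.

Lemma proj_const_ge_pairing :
  ((complex.Re (M (fun x => M (fun z => h z x * k z x))))%:E <= proj_const X)%E.
Proof.
apply: (@le_trans _ _ (rel_proj_const (range supspace_incl))); last first.
  by apply: ereal_sup_ubound; exists Y, supspace_incl.
apply: le_ereal_inf_tmp => _ [P Pproj <-].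
rewrite -(projection_pairing Pproj).
have [Pfin _ _] := Pproj.
have P0 : (0 <= opnorm P)%E.
  apply: (@le_trans _ _ (complex.Re `|P 0|)%:E);
    first by rewrite lee_fin -lecR Re_normK normr_ge0.
  by apply: ereal_sup_ubound; exists 0 => //=; rewrite normr0 ler01.
have Pf : opnorm P = (fine (opnorm P))%:E.
  by rewrite fineK// ge0_fin_numE.
rewrite Pf lee_fin; apply: le_trans (ler_norm _) _.
apply: le_trans (ler_norm_Re _) _; apply: mean_le => z.
apply: le_trans (supspace_norm_ub _ z) _; rewrite -lee_fin -Pf.
apply: ereal_sup_ubound; exists (\sum_i a i z *: B i) => //=.
rewrite -[leLHS]Re_normK -[leRHS]/((1 : R)%:C) lecR.
apply: supspace_norm_le => // w; rewrite val_supspace_sum; exact: h_le1.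
Qed.

End LowerBound.
End ReproducingKernel.

(** * Radial integrals *)

Section SqrtApprox.
Variable R : realType.

(* ['X * sqrt_approx n] are the iterates of [q |-> q + (x - q^2) / 2] from [0],
   which increase to [sqrt x] on [[0, 1]]. *)
Fixpoint sqrt_approx n : {poly R} :=
  if n is m.+1 then
    sqrt_approx m + 2^-1 *: (1 - 'X * sqrt_approx m ^+ 2)
  else 0.

(** Each iteration multiplies the error [s - q] by [1 - (s + q) / 2 <= 1 - s / 2]. The contraction
    degenerates at [s = 0], but the third invariant still yields a rate of order [1/n] uniformly in
    [s]. *)
Lemma sqrt_approx_bounds n (s : R) : 0 <= s -> s <= 1 ->
  let q := s ^+ 2 * (sqrt_approx n).[s ^+ 2] in
  [/\ 0 <= q, q <= s & (s - q) * (1 + n%:R * s / 2) <= s].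
Proof.
move=> s0 s1; elim: n => [|n] /=; first by rewrite horner0 !mulr0 mul0r; split; lra.
set r := (sqrt_approx n).[s ^+ 2]; set q := s ^+ 2 * r; move=> [q0 qs d].
have -> : s ^+ 2 * (sqrt_approx n + 2^-1 *: (1 - 'X * sqrt_approx n ^+ 2)).[s ^+ 2] =
    q + (s ^+ 2 - q ^+ 2) / 2.
  by rewrite !hornerE /= -/r /q; field.
have -> : s - (q + (s ^+ 2 - q ^+ 2) / 2) = (s - q) * (1 - (s + q) / 2) by field.
have sq0 : 0 <= s - q by rewrite subr_ge0.
split.
- apply: addr_ge0 => //; apply: divr_ge0 => //; rewrite subr_ge0.
  by apply: lerXn2r; rewrite ?nnegrE.
- rewrite -subr_ge0.
  have -> : s - (q + (s ^+ 2 - q ^+ 2) / 2) = (s - q) * (1 - (s + q) / 2) by field.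
  by apply: mulr_ge0 => //; lra.
- apply: le_trans d; rewrite -mulrA; apply: ler_wpM2l => //.
  have n0 : 0 <= n%:R :> R by [].
  apply: (@le_trans _ _ ((1 - s / 2) * (1 + n.+1%:R * s / 2))).
    apply: ler_wpM2r; last by lra.
    by rewrite addr_ge0// divr_ge0// mulr_ge0.
  rewrite -(natr1 n) -subr_ge0.
  have -> : 1 + n%:R * s / 2 - (1 - s / 2) * (1 + (n%:R + 1) * s / 2) =
    (n%:R + 1) * s ^+ 2 / 4 by field.
  by rewrite divr_ge0// mulr_ge0 ?addr_ge0 ?sqr_ge0.
Qed.

Lemma sqrt_approx_error n (s : R) : 0 <= s -> s <= 1 ->
  n%:R * (s - s ^+ 2 * (sqrt_approx n).[s ^+ 2]) <= 2.
Proof.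
move=> s0 s1; have [] := sqrt_approx_bounds n s0 s1.
set q := _ * _ => q0 qs d.
have [s00|sn0] := eqVneq s 0.
  have -> : s - q = 0 by move: q0 qs; rewrite s00; lra.
  by rewrite mulr0.
have sp : 0 < s by rewrite lt0r sn0.
rewrite -(ler_pM2r sp); have sq0 : 0 <= s - q by rewrite subr_ge0.
have : (s - q) * (n%:R * s / 2) <= s.
  apply: le_trans d; apply: ler_wpM2l => //; lra.
have -> : (s - q) * (n%:R * s / 2) = (n%:R * (s - q) * s) / 2 by field.
by lra.
Qed.

End SqrtApprox.

(** * Polynomial primitives in place of integrals *)

Section Primitive.
Variable R : realType.
Implicit Types g F : {poly R}.

Definition primitive g : {poly R} :=
  \poly_(j < (size g).+1) (if j is i.+1 then g`_i / j%:R else 0).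

Lemma coef_primitive g j : (primitive g)`_j.+1 = g`_j / j.+1%:R.
Proof.
rewrite coef_poly ltnS; case: ltnP => // gj.
by rewrite nth_default ?mul0r.
Qed.

Lemma deriv_primitive g : (primitive g)^`() = g.
Proof.
by apply/polyP => j; rewrite coef_deriv coef_primitive -[LHS]mulr_natr divfK//.
Qed.

Lemma primitive0 g : (primitive g).[0] = 0.
Proof. by rewrite horner_coef0 coef_poly. Qed.

Lemma primitive1 g : (primitive g).[1] = \sum_(j < size g) g`_j / j.+1%:R.
Proof.
rewrite horner_poly big_ord_recl mul0r add0r; apply: eq_bigr => j _.
by rewrite expr1n mulr1.
Qed.

(* The substitution [t = y^2] turns the half-integral powers of [t] below into
   integral ones. *)
Lemma primitive_sqr_close g F (a b eps : R) : a <= b ->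
  (forall y, a <= y <= b -> `|g.[y ^+ 2] * (2 * y) - F^`().[y]| <= eps) ->
  `|(primitive g).[b ^+ 2] - (primitive g).[a ^+ 2] - (F.[b] - F.[a])| <=
  eps * (b - a).
Proof.
rewrite le_eqVlt => /predU1P[->|ab] gF; first by rewrite !subrr normr0 mulr0.
pose H := primitive g \Po 'X^2 - F.
have -> : (primitive g).[b ^+ 2] - (primitive g).[a ^+ 2] - (F.[b] - F.[a]) =
    H.[b] - H.[a] by rewrite /H !hornerE !horner_comp !hornerE; ring.
have [c + ->] := poly_mvt H ab; rewrite in_itv /= => /andP[/ltW ac /ltW cb].
rewrite normrM (@ger0_norm _ (b - a)) ?subr_ge0 ?(ltW ab)//.
apply: ler_wpM2r; first by rewrite subr_ge0 ltW.
have -> : H^`().[c] = g.[c ^+ 2] * (2 * c) - F^`().[c].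
  rewrite /H derivB deriv_comp deriv_primitive derivXn !hornerE horner_comp !hornerE.
  by rewrite /=; ring.
by apply: gF; rewrite ac cb.
Qed.

End Primitive.

Section RadialIntegral.
Variables (R : realType) (q : nat) (A D s : R).
Let p : R := q.+1%:R.
Hypothesis pA : p <= A.
Hypothesis D0 : 0 < D.
Hypothesis s0 : 0 < s.

Definition radial (y : R) : R := D * y ^+ q * (A * y ^+ 2 - p).

Hypothesis s_le : forall y, 0 <= y <= 1 -> s * `|radial y| <= 1.

(** The square of [s * radial y] as a polynomial in [t = y^2]: squaring removes both the absolute
    value and the half-integral power of [t]. *)
Definition radial_sqr : {poly R} := (s ^+ 2 * D ^+ 2) *: ('X^q * (A *: 'X -
  p%:P) ^+ 2).

Definition radial_approx n : {poly R} :=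
  ('X * sqrt_approx R n) \Po radial_sqr.

Lemma radial_sqrE y : radial_sqr.[y ^+ 2] = (s * `|radial y|) ^+ 2.
Proof.
rewrite exprMn real_normK ?num_real// /radial /radial_sqr !hornerE -exprM mulnC exprM.
by rewrite /=; ring.
Qed.

Lemma radial_approx_bounds n y : 0 <= y <= 1 ->
  0 <= (radial_approx n).[y ^+ 2] <= s * `|radial y| /\
  n%:R * (s * `|radial y| - (radial_approx n).[y ^+ 2]) <= 2.
Proof.
move=> y01; rewrite /radial_approx horner_comp hornerM hornerX radial_sqrE.
have h0 : 0 <= s * `|radial y| by rewrite mulr_ge0// ltW.
have [a b _] := sqrt_approx_bounds n h0 (s_le y01).
by rewrite a b; split => //; exact: (sqrt_approx_error n h0 (s_le y01)).
Qed.

Definition radial_primitive : {poly R} :=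
  D *: ((2 * A / q.+4%:R) *: 'X^(q.+4) - (2 * p / q.+2%:R) *: 'X^(q.+2)).

Lemma radial_primitive_deriv y : radial_primitive^`().[y] = radial y * (2 * y).
Proof.
rewrite /radial_primitive derivZ derivB !derivZ !derivXn.
rewrite hornerZ hornerD hornerN !hornerZ !hornerMn !hornerXn.
have E4 : y ^+ q.+4.-1 = y ^+ q * y ^+ 3 by rewrite -exprD addn3.
have E2 : y ^+ q.+2.-1 = y ^+ q * y by rewrite -exprSr.
have key (N4 N2 z : R) : N4 != 0 -> N2 != 0 ->
    D * (2 * A / N4 * (z * y ^+ 3 * N4) - 2 * p / N2 * (z * y * N2)) =
    D * z * (A * y ^+ 2 - p) * (2 * y).
  by move=> N40 N20; field; rewrite N40 N20.
rewrite -[y ^+ _ *+ q.+4]mulr_natr -[y ^+ _ *+ q.+2]mulr_natr E4 E2.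
by apply: key; rewrite pnatr_eq0.
Qed.

Let sigma := Num.sqrt (p / A).

(** [sigma] is the sign change of [radial] on [[0, 1]], and [radial_primitive] vanishes at 0, so
    this is the integral of [2 y |radial y|] over [[0, 1]]. *)
Definition radial_integral : R :=
  radial_primitive.[1] - 2 * radial_primitive.[sigma].

Lemma radial_integral_approx n :
  n%:R * `|(primitive (radial_approx n)).[1] - s * radial_integral| <= 4.
Proof.
have p0 : 0 < p by rewrite ltr0n.
have A0 : 0 < A by exact: lt_le_trans pA.
have sg0 : 0 <= sigma by exact: sqrtr_ge0.
have sg2 : sigma ^+ 2 = p / A by rewrite sqr_sqrtr// divr_ge0// ltW.
have sg1 : sigma <= 1.
  by rewrite -sqrtr1 ler_sqrt// ler_pdivrMr// mul1r.
have [->|n0] := posnP n; first by rewrite mul0r.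
have nR : 0 < n%:R :> R by rewrite ltr0n.
(* [e] is the constant sign of [radial] on [[a, b]]. The pointwise error is at most [2 / n], and the
   factor [2 * y <= 2] makes it [4 / n]. *)
have close (e : R) (a b : R) : `|e| = 1 -> 0 <= a -> a <= b -> b <= 1 ->
    (forall y, a <= y <= b -> `|radial y| = e * radial y) ->
    `|(primitive (radial_approx n)).[b ^+ 2] - (primitive (radial_approx n)).[a ^+ 2]
      - s * e * (radial_primitive.[b] - radial_primitive.[a])| <= 4 / n%:R * (b - a).
  move=> e1 a0 ab b1 re.
  have := @primitive_sqr_close _ (radial_approx n) ((s * e) *: radial_primitive)
    a b (4 / n%:R) ab.
  rewrite !hornerZ -mulrBr; apply => y /andP[ay yb].
  have y0 := le_trans a0 ay; have y1 := le_trans yb b1.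
  rewrite derivZ hornerZ radial_primitive_deriv.
  have -> : s * e * (radial y * (2 * y)) = s * (e * radial y) * (2 * y) by ring.
  rewrite -re ?ay// -mulrBl normrM.
  have [|/andP[g0 g1] g2] := @radial_approx_bounds n y; first by rewrite y0.
  have hd : 0 <= s * `|radial y| - (radial_approx n).[y ^+ 2] by rewrite subr_ge0.
  rewrite distrC (ger0_norm hd) (@ger0_norm _ (2 * y)) ?mulr_ge0//.
  rewrite ler_pdivlMr// mulrC mulrA.
  have h : 2 * y <= 2 by lra.
  apply: le_trans (ler_wpM2l _ h) _; first by rewrite mulr_ge0// ltW.
  by lra.
have rp0 : radial_primitive.[0] = 0.
  by rewrite /radial_primitive hornerZ hornerD hornerN !hornerZ !hornerXn
    !expr0n /=; ring.
have sgn y : 0 <= y -> (0 <= A * y ^+ 2 - p) = (sigma <= y).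
  move=> y0; rewrite subr_ge0 -ler_pdivrMl// mulrC -sg2.
  by rewrite ler_pXn2r// nnegrE.
have Dy y : 0 <= y -> 0 <= D * y ^+ q by move=> y0; rewrite mulr_ge0 ?exprn_ge0// ltW.
have h1 := close (-1) 0 sigma; have h2 := close 1 sigma 1.
have {}h1 : `|(primitive (radial_approx n)).[sigma ^+ 2]
    + s * radial_primitive.[sigma]| <= 4 / n%:R * sigma.
  have := h1 _ (lexx 0) sg0 sg1; rewrite normrN1 expr0n primitive0 rp0 !subr0.
  rewrite mulrN1 mulNr opprK; apply => // y /andP[y0 ys].
  rewrite /radial normrM ger0_norm ?Dy// mulN1r -mulrN; congr (_ * _).
  rewrite ler0_norm// leNgt; apply/negP => lt0.
  have := sgn y y0; rewrite (ltW lt0) => /esym sy.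
  have E : y = sigma by apply/eqP; rewrite eq_le ys sy.
  by move: lt0; rewrite E sg2 mulrC divfK ?subrr ?ltxx// lt0r_neq0.
have {}h2 : `|(primitive (radial_approx n)).[1] - (primitive (radial_approx
  n)).[sigma ^+ 2]
    - s * (radial_primitive.[1] - radial_primitive.[sigma])| <= 4 / n%:R * (1 -
      sigma).
  have := h2 _ sg0 sg1 (lexx 1); rewrite normr1 mulr1 expr1n;
    apply => // y /andP[ys y1].
  have y0 := le_trans sg0 ys.
  by rewrite mul1r /radial normrM ger0_norm ?Dy// ger0_norm// sgn.
rewrite -ler_pdivlMl// [leRHS]mulrC.
have -> : 4 / n%:R = 4 / n%:R * sigma + 4 / n%:R * (1 - sigma) :> R by ring.
apply: le_trans (lerD h1 h2); apply: le_trans (ler_normD _ _).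
by rewrite /radial_integral le_eqVlt; apply/predU1P; left; congr `|_|; ring.
Qed.

End RadialIntegral.

(** * Zonal kernels *)

Lemma natmul_bounded_le0 (R : realType) (x B : R) :
  (forall n : nat, n%:R * x <= B) -> x <= 0.
Proof.
move=> xB; rewrite leNgt; apply/negP => x0.
have := xB (Num.truncn (B / x)).+1; rewrite -ler_pdivlMr// leNgt.
by rewrite truncnS_gt.
Qed.

(** * Kernels of finite rank *)

Section Separable.
Variables (R : realType) (T : Type) (P : set (T -> R[i])).
Implicit Types h : T -> T -> R[i].

(** Left factors are constrained by [P]: they lie in [X] for the reproducing kernel and are merely
    bounded for the test functions. *)
Definition separable_in h := exists (J : finType) (a b : J -> T -> R[i]),
  [/\ forall j, P (a j), forall j, bnd (b j) &
      forall z w, h z w = \sum_j a j z * b j w].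

Lemma separable_in_left f : P f -> separable_in (fun z _ => f z).
Proof.
move=> fP; exists unit, (fun=> f), (fun _ _ => 1); split=> //.
  by move=> _; exact: bnd_cst.
by move=> z w; rewrite big_const card_unit /= addr0 mulr1.
Qed.

Lemma separable_inD h h' : separable_in h -> separable_in h' ->
  separable_in (fun z w => h z w + h' z w).
Proof.
move=> [J [a [b [ab bb hE]]]] [J' [a' [b' [ab' bb' hE']]]].
exists (J + J')%type, (fun j => match j with inl i => a i | inr i => a' i end),
  (fun j => match j with inl i => b i | inr i => b' i end).
split; [by case|by case|].
by move=> z w; rewrite hE hE' big_sumType.
Qed.

Lemma separable_inMr h f : separable_in h -> bnd f ->
  separable_in (fun z w => h z w * f w).
Proof.
move=> [J [a [b [ab bb hE]]]] fb; exists J, a, (fun j w => b j w * f w).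
split=> // [j|z w]; first exact: bndM.
by rewrite hE mulr_suml; apply: eq_bigr => j _; rewrite mulrA.
Qed.

Lemma separable_in_sum n (F : 'I_n.+1 -> T -> T -> R[i]) :
  (forall i, separable_in (F i)) -> separable_in (fun z w => \sum_i F i z w).
Proof.
elim: n F => [|n IH] F Fs.
  rewrite (_ : (fun z w => _) = F ord0) //.
  by apply/funext => z; apply/funext => w; rewrite big_ord1.
rewrite (_ : (fun z w => _) = fun z w => F ord0 z w + \sum_(i < n.+1) F (lift
  ord0 i) z w).
  by apply: separable_inD => //; exact: IH.
by apply/funext => z; apply/funext => w; rewrite big_ord_recl.
Qed.

End Separable.

Section SeparableBounded.
Variables (R : realType) (T : Type).
Local Notation separable_in := (@separable_in R T (@bnd R T)).
Implicit Types h : T -> T -> R[i].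

Lemma separable_in_cst c : separable_in (fun _ _ => c).
Proof. by apply: (@separable_in_left R T (@bnd R T) (fun=> c)); exact: bnd_cst. Qed.

Lemma separable_in_right f : bnd f -> separable_in (fun _ w => f w).
Proof.
move=> fb; rewrite (_ : (fun _ w => f w) = fun _ w => 1 * f w).
  by apply: separable_inMr => //; exact: separable_in_cst.
by apply/funext => z; apply/funext => w; rewrite mul1r.
Qed.

Lemma separable_inM h h' : separable_in h -> separable_in h' ->
  separable_in (fun z w => h z w * h' z w).
Proof.
move=> [J [a [b [ab bb hE]]]] [J' [a' [b' [ab' bb' hE']]]].
exists (J * J')%type, (fun j z => a j.1 z * a' j.2 z),
  (fun j w => b j.1 w * b' j.2 w).
split; [by move=> j; exact: bndM|by move=> j; exact: bndM|] => z w.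
rewrite hE hE' mulr_suml -(pair_bigA _ (fun j j' =>
  a j z * a' j' z * (b j w * b' j' w))) /=.
apply: eq_bigr => j _; rewrite mulr_sumr; apply: eq_bigr => j' _; ring.
Qed.

Lemma separable_inX h n : separable_in h -> separable_in (fun z w => h z w ^+ n).
Proof.
move=> hs; elim: n => [|n IH]; first exact: separable_in_cst.
rewrite (_ : (fun z w => _) = fun z w => h z w * h z w ^+ n);
  first exact: separable_inM.
by apply/funext => z; apply/funext => w; rewrite exprS.
Qed.

End SeparableBounded.

Section Zonal.
Variable R : realType.
Local Notation S := (csphere R 2).
Local Notation M := (sphere_mean R).
Implicit Types (z w x : S) (g : {poly R}).

Definition inner_norm z w : R := complex.Re `|inner z w|.

Lemma inner_norm_sqr z w : (inner_norm z w ^+ 2)%:C = inner z w * inner w z.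
Proof. by rewrite norm_sqrC inner_conj. Qed.

Lemma inner_normC z w : inner_norm z w = inner_norm w z.
Proof. by rewrite /inner_norm -inner_conj normcJ. Qed.

(** Cauchy-Schwarz by the Lagrange identity: the defect is [|z0 w1 - z1 w0|^2]. *)
Lemma inner_norm_itv z w : 0 <= inner_norm z w <= 1.
Proof.
rewrite Re_norm_ge0 -(@ler_pXn2r _ 2) ?nnegrE ?Re_norm_ge0//= expr1n -subr_ge0 -lecR.
rewrite (rmorphB (real_complex R)) /= inner_norm_sqr.
pose d := scoord 0 z * scoord 1 w - scoord 1 z * scoord 0 w.
suff -> : (1 : R)%:C - inner z w * inner w z = d * d^*%C by rewrite mulcJ_ge0.
rewrite /d (rmorphB (@conjc R)) /= !conjcM.
rewrite -[LHS]/(1 - _) -{1}(mulr1 1) -{1}(coord_sphere z) -(coord_sphere w)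
  /inner; ring.
Qed.

Local Notation bseparable := (@separable_in R S (@bnd R S)).

Lemma separable_inner : bseparable (@inner R).
Proof.
apply: separable_inD; apply: separable_inM.
all: do ?[by apply: (@separable_in_left R S (@bnd R S)); exact: bnd_coord].
all: by apply: separable_in_right; apply: bnd_conj; exact: bnd_coord.
Qed.

Lemma separable_innerC : bseparable (fun z w => inner w z).
Proof.
apply: separable_inD; apply: separable_inM.
all: do ?[by apply: separable_in_right; exact: bnd_coord].
all: by apply: (@separable_in_left R S (@bnd R S)); apply: bnd_conj; exact: bnd_coord.
Qed.

Lemma horner_inner g z w : (g.[inner_norm z w ^+ 2])%:C =
  \sum_(j < size g) (g`_j)%:C * (inner w z ^+ j * inner z w ^+ j).
Proof.
rewrite horner_coef (rmorph_sum (real_complex R)); apply: eq_bigr => j _.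
rewrite (rmorphM (real_complex R)) (rmorphXn (real_complex R)) /= inner_norm_sqr.
by rewrite -exprMn [inner z w * _]mulrC.
Qed.

Lemma separable_horner g :
  bseparable (fun z w => (g.[inner_norm z w ^+ 2])%:C).
Proof.
(* A zero term is added because [separable_in_sum] takes nonempty sums, while [size g] may be 0. *)
rewrite (_ : (fun z w => _) = fun z w =>
    \sum_(j < (size g).+1) (g`_j)%:C * (inner w z ^+ j * inner z w ^+ j)); last first.
  apply/funext => z; apply/funext => w; rewrite horner_inner.
  by rewrite big_ord_recr /= nth_default// mul0r addr0.
apply: separable_in_sum => j; apply: separable_inM; first exact: separable_in_cst.
by apply: separable_inM; apply: separable_inX;
  [exact: separable_innerC|exact: separable_inner].
Qed.

(** [|<z, w>|^2] has the moments [1 / (j + 1)] of the uniform law, by [zonal_moment_holo] with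
    [a = b = j]. *)
Lemma mean_horner_inner g w :
  M (fun z => (g.[inner_norm z w ^+ 2])%:C) = ((primitive g).[1])%:C.
Proof.
under eq_fun do rewrite horner_inner.
have ib j : bnd (fun z => inner w z ^+ j * inner z w ^+ j).
  by apply: bndM; apply: bndX; [exact: bnd_innerr|exact: bnd_innerl].
rewrite mean_sum => [|j]; last by apply: bndM => //; exact: bnd_cst.
rewrite primitive1 (rmorph_sum (real_complex R)); apply: eq_bigr => j _.
rewrite meanZ// (rmorphM (real_complex R)) (fmorphV (real_complex R)).
rewrite (rmorph_nat (real_complex R)) /=; congr (_ * _).
have := @zonal_moment_holo R w j j 0 0; rewrite !addn0 => /(_ erefl).
rewrite !expr0 !mul1r => <-; congr (M _); apply/funext => z.
by rewrite /monom !expr0 !mulr1.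
Qed.

Section ZonalKernel.
Variables (q : nat) (A D : R).
Let p : R := q.+1%:R.
Hypothesis pA : p <= A.
Hypothesis D0 : 0 < D.

(** With [A = p+1], [D = p+2] this is the kernel of [H_(p,1)]. Adding [p u^(p-1)], the kernel of
    [|z|^2 H_(p-1,0)], gives [A = p+2], [D = p+1], the kernel of the full space. *)
Definition zonal_kernel z x : R[i] :=
  D%:C * inner z x ^+ q * (A%:C * (inner z x * inner x z) - p%:C).

Lemma norm_zonal_kernel z x :
  complex.Re `|zonal_kernel z x| = `|radial q A D (inner_norm z x)|.
Proof.
have -> : zonal_kernel z x =
    D%:C * inner z x ^+ q * (A * inner_norm z x ^+ 2 - p)%:C.
  by rewrite (rmorphB (real_complex R)) (rmorphM (real_complex R)) /= inner_norm_sqr.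
rewrite !Re_normM !norm_real /radial !normrM; congr (_ * _ * _).
by rewrite Re_normX normrX /inner_norm (ger0_norm (Re_norm_ge0 _)).
Qed.

Let p0 : 0 < p. Proof. by rewrite ltr0n. Qed.
Let A0 : 0 < A. Proof. exact: lt_le_trans pA. Qed.
(** Scales the kernel into [[0, 1]], where the square root iteration converges: [|A y^2 - p| <= A]
    since [p <= A]. *)
Let s : R := (D * A)^-1.
Let s0 : 0 < s. Proof. by rewrite invr_gt0 mulr_gt0. Qed.

Lemma radial_scaled_le1 y : 0 <= y <= 1 -> s * `|radial q A D y| <= 1.
Proof.
move=> /andP[y0 y1]; rewrite mulrC ler_pdivrMr ?mulr_gt0// mul1r /radial !normrM.
rewrite (gtr0_norm D0) -mulrA ler_pM2l// normrX (ger0_norm y0).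
apply: (@le_trans _ _ (1 * `|A * y ^+ 2 - p|)).
  by apply: ler_wpM2r => //; exact: exprn_ile1.
have y2 : y ^+ 2 <= 1 by exact: exprn_ile1.
have y20 : 0 <= y ^+ 2 by exact: exprn_ge0.
have := ler_wpM2l (ltW A0) y2; have := mulr_ge0 (ltW A0) y20.
by rewrite mul1r ler_norml mulr1; move: pA p0; lra.
Qed.

Let C := radial_integral q A D.

Lemma bnd_zonal_kernel z : bnd (zonal_kernel z).
Proof.
exists (s^-1) => x; rewrite norm_zonal_kernel -[leRHS]mulr1 ler_pdivlMl//.
exact: radial_scaled_le1 (inner_norm_itv _ _).
Qed.

Lemma mean_norm_zonal_kernel z :
  complex.Re (M (fun x => `|zonal_kernel z x|)) <= C.
Proof.
have kb := bnd_norm (bnd_zonal_kernel z).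
(* 6 = 4 + 2: the error of [radial_integral_approx] and the pointwise error of the approximation. *)
rewrite -subr_le0 -(pmulr_rle0 _ s0); apply: (@natmul_bounded_le0 _ _ 6) => n.
set m := complex.Re _; set G := radial_approx q A D s n.
have [->|n0] := posnP n; first by rewrite mul0r.
have nR : 0 < n%:R :> R by rewrite ltr0n.
have := radial_integral_approx pA D0 s0 radial_scaled_le1 n; rewrite -/G -/C => GC.
have {}GC : n%:R * ((primitive G).[1] - s * C) <= 4.
  by apply: le_trans GC; rewrite ler_pM2l// ler_norm.
have Gb : bnd (fun x => (G.[inner_norm x z ^+ 2])%:C).
  under eq_fun do rewrite horner_inner.
  apply: bnd_sum => j; apply: bndM; first exact: bnd_cst.
  by apply: bndM; apply: bndX; [exact: bnd_innerr|exact: bnd_innerl].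
suff : s * m <= (primitive G).[1] + 2 / n%:R.
  rewrite -(ler_pM2l nR) mulrDr [n%:R * (2 / _)]mulrCA divff ?mulr1 ?lt0r_neq0//.
  by move: GC; lra.
have -> : s * m = complex.Re (M (fun x => s%:C * `|zonal_kernel z x|)).
  by rewrite meanZ// Re_scale.
have -> : (primitive G).[1] + 2 / n%:R =
    complex.Re (M (fun x => (G.[inner_norm x z ^+ 2])%:C + (2 / n%:R)%:C)).
  by rewrite meanD ?mean_horner_inner ?mean_cst//; exact: bnd_cst.
apply: mean_mono => [||x].
- by apply: bndM => //; exact: bnd_cst.
- by apply: bndD => //; exact: bnd_cst.
rewrite Re_scale norm_zonal_kernel inner_normC.
rewrite [leRHS]/= -lerBlDl ler_pdivlMr// mulrC.
by have [_] := radial_approx_bounds s0 radial_scaled_le1 n (inner_norm_itv x z).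
Qed.

(* The test functions: [conj k] times a polynomial approximation of [1 / |k|]. *)
Definition sign_poly n : {poly R} :=
  ((s * D) *: (A *: 'X - p%:P)) * (sqrt_approx R n \Po radial_sqr q A D s).

Definition sign_kernel n z w : R[i] :=
  inner w z ^+ q * ((sign_poly n).[inner_norm z w ^+ 2])%:C.

Lemma separable_sign_kernel n : bseparable (sign_kernel n).
Proof.
apply: separable_inM; last exact: separable_horner.
by apply: separable_inX; exact: separable_innerC.
Qed.

Lemma sign_kernel_le1 n z w : complex.Re `|sign_kernel n z w| <= 1.
Proof.
rewrite /sign_kernel Re_normM norm_real.
have -> : complex.Re `|inner w z ^+ q| = inner_norm z w ^+ q.
  by rewrite inner_normC Re_normX.
set y := inner_norm z w; have y01 : 0 <= y <= 1 by exact: inner_norm_itv.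
set r := (sqrt_approx R n).[(s * `|radial q A D y|) ^+ 2].
have -> : (sign_poly n).[y ^+ 2] = s * D * (A * y ^+ 2 - p) * r.
  by rewrite /sign_poly hornerM horner_comp radial_sqrE !hornerE.
have -> : y ^+ q * `|s * D * (A * y ^+ 2 - p) * r| = `|s * `|radial q A D y| * r|.
  rewrite /radial !normrM !normr_id normrX (gtr0_norm D0) (gtr0_norm s0).
  by rewrite (@ger0_norm _ y); [ring|case/andP: y01].
have h0 : 0 <= s * `|radial q A D y| by rewrite mulr_ge0// ltW.
have [+ + _] := sqrt_approx_bounds n h0 (radial_scaled_le1 y01).
(* The bounds read [0 <= t^2 r <= t]; dividing by [t] bounds [t r], and [t = 0] is trivial. *)
rewrite -/r; move: (s * _) h0 => t; rewrite le_eqVlt => /predU1P[<-|t0].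
  by rewrite mul0r normr0 ler01.
rewrite expr2 -mulrA pmulr_rge0// => tr0.
by rewrite -[leRHS]mulr1 ler_pM2l// ger0_norm.
Qed.

(** The phases of [<x, z>^q] and [<z, x>^q] cancel, so the product is exactly a polynomial in
    [|<z, x>|^2], the approximation of [|k|]. *)
Lemma mean_sign_kernel n x :
  M (fun z => sign_kernel n z x * zonal_kernel z x) =
  (s^-1 * (primitive (radial_approx q A D s n)).[1])%:C.
Proof.
rewrite (rmorphM (real_complex R)) /= -(mean_horner_inner _ x) -meanZ; last first.
  under eq_fun do rewrite horner_inner.
  apply: bnd_sum => j; apply: bndM; first exact: bnd_cst.
  by apply: bndM; apply: bndX; [exact: bnd_innerr|exact: bnd_innerl].
congr (M _); apply/funext => z; rewrite -(rmorphM (real_complex R)) /=.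
have -> : s^-1 * (radial_approx q A D s n).[inner_norm z x ^+ 2] =
   (inner_norm z x ^+ 2) ^+ q * D * (A * inner_norm z x ^+ 2 - p) *
   (sign_poly n).[inner_norm z x ^+ 2].
  rewrite /radial_approx /sign_poly horner_comp !hornerM hornerX horner_comp.
  rewrite {1}/radial_sqr !hornerE /=; field.
  by rewrite lt0r_neq0.
rewrite !(rmorphM (real_complex R)) (rmorphB (real_complex R)).
rewrite (rmorphM (real_complex R)) (rmorphXn (real_complex R)) /= inner_norm_sqr.
by rewrite /sign_kernel /zonal_kernel exprMn; ring.
Qed.

(** Expanding [sign_poly] gives a sum of terms covered by [zonal_laplacian], with coefficients
    independent of [F] and [w]. *)
Lemma mean_sign_kernel_stable n : exists alpha beta : R[i],
  forall F : 'rV[R[i]]_2 -> R[i], bihomog q.+1 1 F -> forall w,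
  M (fun z => sign_kernel n z w * F (val z)) =
  alpha * F (val w) + beta * laplacian F (val w).
Proof.
set g := sign_poly n; pose u j : R[i] := ((q + j).+1%:R * (q + j).+2%:R)^-1.
exists (\sum_(j < size g) (g`_j)%:C * (j%:R * u j)), (\sum_(j < size g)
  (g`_j)%:C * u j).
move=> F Fb w; have Fbnd := bnd_rpoly (bihomog_rpoly Fb).
have zb j : bnd (fun z => inner w z ^+ (q + j) * (inner z w ^+ j * F (val z))).
  apply: bndM; first by apply: bndX; exact: bnd_innerr.
  by apply: bndM => //; apply: bndX; exact: bnd_innerl.
transitivity (M (fun z => \sum_(j < size g) (g`_j)%:C *
    (inner w z ^+ (q + j) * (inner z w ^+ j * F (val z))))).
  congr (M _); apply/funext => z; rewrite /sign_kernel horner_inner mulr_sumr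
    mulr_suml.
  by apply: eq_bigr => j _; rewrite exprD; ring.
rewrite mean_sum => [|j]; last by apply: bndM => //; exact: bnd_cst.
rewrite !mulr_suml -big_split /=; apply: eq_bigr => j _.
rewrite meanZ// zonal_laplacian// -/(u j).
by move: (F _) (laplacian _ _) (u j) => a b c; ring.
Qed.

(** This dictates the constants. The coefficient of [F] requires [D * A = q.+2 * q.+3]; on the full
    space [A = q.+3] cancels the Laplacian, while in the harmonic case [A = q.+2] makes the kernel
    itself harmonic. *)
Lemma mean_zonal_kernel (F : 'rV[R[i]]_2 -> R[i]) z : bihomog q.+1 1 F ->
  M (fun x => zonal_kernel z x * F (val x)) =
  D%:C * (A%:C * ((F (val z) + laplacian F (val z)) / (q.+2%:R * q.+3%:R)) -
          p%:C * (laplacian F (val z) / (q.+1%:R * q.+2%:R))).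
Proof.
move=> Fb; have Fbnd := bnd_rpoly (bihomog_rpoly Fb).
have zb j : bnd (fun x => inner z x ^+ (q + j) * (inner x z ^+ j * F (val x))).
  apply: bndM; first by apply: bndX; exact: bnd_innerr.
  by apply: bndM => //; apply: bndX; exact: bnd_innerl.
have Z0 := zonal_laplacian 0 z Fb; have Z1 := zonal_laplacian 1 z Fb.
rewrite addn0 in Z0; rewrite addn1 in Z1.
rewrite mul0r add0r in Z0; rewrite mul1r in Z1.
rewrite -Z0 -Z1.
have zb0 := zb 0%N; have zb1 := zb 1%N; rewrite addn0 in zb0; rewrite addn1 in zb1.
transitivity (M (fun x =>
    (D%:C * A%:C) * (inner z x ^+ q.+1 * (inner x z ^+ 1 * F (val x))) +
    - (D%:C * p%:C) * (inner z x ^+ q * (inner x z ^+ 0 * F (val x))))).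
  congr (M _); apply/funext => x.
  by rewrite /zonal_kernel expr0 expr1 exprS; ring.
rewrite meanD ?meanZ//; last 2 first.
- by apply: bndM => //; exact: bnd_cst.
- by apply: bndM => //; exact: bnd_cst.
by move: (M _) (M _) => a b; ring.
Qed.

Section ProjConst.
Variable X : supspace R S.
Hypothesis X_bihomog : forall f, supspace_set X f ->
  exists2 F, bihomog q.+1 1 F /\ f = (fun z => F (val z)) &
  forall alpha beta : R[i], supspace_set X
    (fun w => alpha * F (val w) + beta * laplacian F (val w)).
Hypothesis k_dec : separable_in (supspace_set X) zonal_kernel.
Hypothesis k_rep : forall f, supspace_set X f ->
  forall z, M (fun x => zonal_kernel z x * f x) = f z.

Theorem zonal_proj_const : proj_const X = C%:E.
Proof.
have [I [e [c [e_in c_bnd kE]]]] := k_dec.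
apply/eqP; rewrite eq_le; apply/andP; split.
  apply: (proj_const_le e_in c_bnd kE k_rep) => [|z].
    (* Nonnegativity of [C] follows from the mean of [|k|] at any point; the coarsest grid supplies
       one. *)
    pose z := sphere_grid R ((ord0, ord0, ord0) : grid_index 0).
    apply: le_trans (mean_norm_zonal_kernel z).
    apply: (@le_trans _ _ (complex.Re (M (fun=> 0)))); first by rewrite mean_cst.
    apply: mean_mono => [||x]; first exact: bnd_cst.
      by apply: bnd_norm; exact: bnd_zonal_kernel.
    by rewrite [`|_|]normc_def /= sqrtr_ge0.
  exact: mean_norm_zonal_kernel.
apply/lee_addgt0Pr => eps eps0; rewrite -leeBlDr//.
(* With this [n] the error [4 / n] is at most [s * eps], hence at most [eps] after division by
   [s]. *)
pose n := (Num.truncn (4 / (s * eps))).+1.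
have nR : 4 <= n%:R * (s * eps).
  by rewrite -ler_pdivrMr ?mulr_gt0// ltW// truncnS_gt.
have [J [a [b [ab bb hE]]]] := separable_sign_kernel n.
have hE' : (fun z w => \sum_j a j z * b j w) = sign_kernel n.
  by apply/funext => z; apply/funext => w; rewrite hE.
have h1 z w : complex.Re `|\sum_j a j z * b j w| <= 1.
  by rewrite -hE; exact: sign_kernel_le1.
have hX f : supspace_set X f ->
    supspace_set X (fun w => M (fun z => (\sum_j a j z * b j w) * f z)).
  move=> /X_bihomog[F [Fb ->] FX]; have [al [be alE]] := mean_sign_kernel_stable n.
  rewrite (_ : (fun w => _) = fun w => al * F (val w) + be * laplacian F (val w))//.
  apply/funext => w; rewrite -alE//; congr (M _); apply/funext => z.
  by rewrite hE.
apply: le_trans (proj_const_ge_pairing e_in c_bnd kE k_rep ab bb h1 hX).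
rewrite (_ : (fun x => _) = fun=> (s^-1 * (primitive (radial_approx q A D s
  n)).[1])%:C).
  rewrite mean_cst /= -EFinB lee_fin ler_pdivlMl//.
  have := radial_integral_approx pA D0 s0 radial_scaled_le1 n; rewrite -/C => GC.
  have n0 : 0 < n%:R :> R by rewrite ltr0n.
  have {}GC := le_trans GC nR; rewrite ler_pM2l// in GC.
  by move: GC; rewrite ler_distl => /andP[+ _]; lra.
apply/funext => x; rewrite -(mean_sign_kernel n x); congr (M _); apply/funext => z.
by rewrite hE.
Qed.

End ProjConst.
End ZonalKernel.
End Zonal.

(** * The two spaces *)

Section BinomialSums.
Variable K : comNzRingType.
Implicit Types x y : K.

Lemma binomial_sum n x y :
  \sum_(k < n.+1) 'C(n, k)%:R * (x ^+ k * y ^+ (n - k)) = (x + y) ^+ n.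
Proof.
rewrite addrC exprDn; apply: eq_bigr => k _.
by rewrite -[RHS]mulr_natl [y ^+ _ * _]mulrC.
Qed.

(** This and [binomial_sum_right] are the binomial theorem of exponent [n.+1] differentiated in [x]
    and in [y]. *)
Lemma binomial_sum_left n x y :
  \sum_(k < n.+2) 'C(n.+1, k)%:R * (k%:R * (x ^+ k.-1 * y ^+ (n.+1 - k))) =
  n.+1%:R * (x + y) ^+ n.
Proof.
rewrite big_ord_recl mul0r mulr0 add0r -binomial_sum mulr_sumr.
apply: eq_bigr => k _; rewrite lift0 subSS !mulrA; congr (_ * _ * _).
by rewrite -!natrM mulnC -mul_bin_diag.
Qed.

Lemma binomial_sum_right n x y :
  \sum_(k < n.+2) 'C(n.+1, k)%:R * ((n.+1 - k)%:R * (x ^+ k * y ^+ (n.+1 - k).-1)) =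
  n.+1%:R * (x + y) ^+ n.
Proof.
rewrite big_ord_recr /= subnn mul0r mulr0 addr0 -binomial_sum mulr_sumr.
apply: eq_bigr => k _ /=; rewrite subSn -1?ltnS//= !mulrA; congr (_ * _ * _).
by rewrite -!natrM -subSn -1?ltnS// mulnC -mul_bin_down.
Qed.

End BinomialSums.

Section TwoSpaces.
Variable R : realType.
Local Notation S := (csphere R 2).
Local Notation V := 'rV[R[i]]_2.
Local Notation M := (sphere_mean R).

Lemma natc (m : nat) : (m%:R : R)%:C = m%:R :> R[i].
Proof. exact: rmorph_nat. Qed.

Lemma bihomog_scale p q (l : R[i]) (f : V -> R[i]) :
  bihomog p q f -> bihomog p q (fun z => l * f z).
Proof.
move=> fb; under eq_fun do rewrite -[_ * _]addr0.
by apply: bihomogDZ => //; exact: bihomog0.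
Qed.

Section Bihomogeneous.
Variable q : nat.
Local Notation X := (bihomog_sphere R 2 q.+1 1).

Lemma plane_monom_sphere c c' d d' : (c + d)%N = q.+1 -> (c' + d')%N = 1%N ->
  supspace_set X (fun z => plane_monom c c' d d' (val z)).
Proof.
move=> cd cd'; exists (plane_monom c c' d d') => //.
by have := bihomog_monom R c c' d d'; rewrite cd cd'.
Qed.

Lemma bihomog_kernel_separable :
  separable_in (supspace_set X) (zonal_kernel q q.+3%:R q.+2%:R).
Proof.
pose r n (k : nat) (x : S) : R[i] :=
  (scoord 0 x)^*%C ^+ k * (scoord 1 x)^*%C ^+ (n - k).
have rb n k : bnd (r n k).
  by apply: bndM; apply: bndX; apply: bnd_conj; exact: bnd_coord.
pose m c c' d d' (z : S) := @plane_monom R c c' d d' (val z).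
have kE : zonal_kernel q q.+3%:R q.+2%:R = fun z x =>
  (\sum_(k < q.+2) (m k 1%N (q.+1 - k)%N 0%N z * (q.+2%:R * q.+3%:R * 'C(q.+1,
    k)%:R * r q.+1 k x * scoord 0 x) +
                  m k 0%N (q.+1 - k)%N 1%N z * (q.+2%:R * q.+3%:R * 'C(q.+1,
                    k)%:R * r q.+1 k x * scoord 1 x))) +
  \sum_(k < q.+1) (m k.+1 1%N (q - k)%N 0%N z * (- (q.+2%:R * q.+1%:R) * 'C(q,
    k)%:R * r q k x) +
                  m k 0%N (q - k).+1%N 1%N z * (- (q.+2%:R * q.+1%:R) * 'C(q,
                    k)%:R * r q k x)).
  apply/funext => z; apply/funext => x.
  set u := inner z x.
  (* Multiplying the lower-order term by [|z|^2 = 1] raises its bidegree from [(q, 0)] to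
     [(q.+1, 1)]. *)
  have -> : zonal_kernel q q.+3%:R q.+2%:R z x =
    (q.+2%:R * q.+3%:R * inner x z) * u ^+ q.+1 +
    (- (q.+2%:R * q.+1%:R) *
     (scoord 0 z * (scoord 0 z)^*%C + scoord 1 z * (scoord 1 z)^*%C)) * u ^+ q.
    by rewrite /zonal_kernel !natc coord_sphere -/u exprS; ring.
  rewrite {1 2}/u /inner -!binomial_sum !mulr_sumr; congr (_ + _);
    apply: eq_bigr => k _.
    by rewrite /m /r /plane_monom /scoord !exprMn !expr0 !expr1; ring.
  by rewrite /m /r /plane_monom /scoord !exprMn !exprS !expr0; ring.
rewrite kE.
have sm c c' d d' f : (c + d)%N = q.+1 -> (c' + d')%N = 1%N -> bnd f ->
    separable_in (supspace_set X) (fun z x => m c c' d d' z * f x).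
  move=> cd cd' fb; apply: separable_inMr => //.
  by apply: separable_in_left; exact: plane_monom_sphere.
apply: separable_inD; apply: separable_in_sum => k; apply: separable_inD;
  apply: sm => //.
all: do ?[by apply: bndM => //; exact: bnd_cst].
all: do ?[by apply: bndM; [apply: bndM => //; exact: bnd_cst|exact: bnd_coord]].
all: by rewrite ?addSn ?addnS subnKC// -ltnS.
Qed.

Lemma bihomog_proj_const : proj_const X =
  (radial_integral q q.+3%:R q.+2%:R)%:E.
Proof.
apply: zonal_proj_const => //; [by rewrite ler_nat -addn2 leq_addr|..].
- move=> _ [F Fb <-]; exists F => // al be.
  have [G Gb GE] := bihomog_laplacian Fb.
  exists (fun z => al * F z + be * G z).
    by apply: bihomogDZ => //; exact: bihomog_scale.
  by apply/funext => w; rewrite GE.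
- exact: bihomog_kernel_separable.
- move=> _ [F Fb <-] z; rewrite mean_zonal_kernel// !natc.
  have n0 k : (k.+1%:R : R[i]) != 0 by rewrite pnatr_eq0.
  have key (a b N1 N2 N3 : R[i]) : N1 != 0 -> N2 != 0 -> N3 != 0 ->
      N2 * (N3 * ((a + b) / (N2 * N3)) - N1 * (b / (N1 * N2))) = a.
    by move=> h1 h2 h3; field; rewrite h1 h2 h3.
  exact: key.
Qed.

End Bihomogeneous.

Section Harmonic.
Variable q : nat.
Local Notation X := (harmonic_sphere R 2 q.+1 1).

(* [conj z1 * d0 G - conj z0 * d1 G] for [G = z0^c z1^d]: it is harmonic since
   [d0] and [d1] commute. *)
Definition plane_harmonic c d (z : V) : R[i] :=
  c%:R * plane_monom c.-1 0 d 1 z + - d%:R * plane_monom c 1 d.-1 0 z.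

Lemma plane_harmonic_in c d : (c + d)%N = q.+2 ->
  Defs.harmonic q.+1 1 (plane_harmonic c d).
Proof.
move=> cd.
have b0 : bihomog q.+1 1 (fun z : V => c%:R * plane_monom c.-1 0 d 1 z).
  case: c cd => [|c] cd.
    by under eq_fun do rewrite mul0r; exact: bihomog0.
  apply: bihomog_scale; have := bihomog_monom R c 0 d 1.
  by move: cd; rewrite addSn => -[->].
have b1 : bihomog q.+1 1 (fun z : V => - d%:R * plane_monom c 1 d.-1 0 z).
  case: d cd {b0} => [|d] cd.
    by under eq_fun do rewrite oppr0 mul0r; exact: bihomog0.
  apply: bihomog_scale; have := bihomog_monom R c 1 d 0.
  by move: cd; rewrite addnS => -[->].
split.
  rewrite (_ : plane_harmonic c d = fun z => 1 * (c%:R * plane_monom c.-1 0 d 1 z) +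
    - d%:R * plane_monom c 1 d.-1 0 z); first exact: bihomogDZ.
  by apply/funext => z; rewrite mul1r.
move=> z.
have mp a b a' b' := bihomog_rpoly (bihomog_monom R a b a' b').
rewrite (_ : plane_harmonic c d = fun z => c%:R * plane_monom c.-1 0 d 1 z +
  (- d%:R * plane_monom c 1 d.-1 0 z + 0)); last first.
  by apply/funext => x; rewrite addr0.
rewrite laplacian_lin//; last first.
  apply: rpoly_add; last exact: (rpoly_cst 2 0).
  by apply: rpoly_scale; exact: mp.
rewrite laplacian_lin//; last exact: (rpoly_cst 2 0).
rewrite laplacian0 laplacian_monom0 laplacian_monom1.
by move: (plane_monom _ _ _ _ _) => t; ring.
Qed.

(* The kernel is the multiple by [q.+3] of the harmonic function attached in this
   way to [G = <z, x>^(q.+1) (z0 x1 - z1 x0)], expanded into monomials. *)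
Lemma harmonic_kernel_separable :
  separable_in (supspace_set X) (zonal_kernel q q.+2%:R q.+3%:R).
Proof.
pose r (k : nat) (x : S) : R[i] :=
  (scoord 0 x)^*%C ^+ k * (scoord 1 x)^*%C ^+ (q.+1 - k).
have rb k : bnd (r k).
  by apply: bndM; apply: bndX; apply: bnd_conj; exact: bnd_coord.
have kE : zonal_kernel q q.+2%:R q.+3%:R = fun z x => \sum_(k < q.+2)
    (plane_harmonic k.+1 (q.+1 - k)%N (val z) *
       (q.+3%:R * 'C(q.+1, k)%:R * r k x * scoord 1 x) +
     plane_harmonic k (q.+1 - k).+1%N (val z) *
       (- q.+3%:R * 'C(q.+1, k)%:R * r k x * scoord 0 x)).
  apply/funext => z; apply/funext => x.
  set z0 := scoord 0 z; set z1 := scoord 1 z; set x0 := scoord 0 x;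
    set x1 := scoord 1 x.
  pose a := z0 * x0^*%C; pose b := z1 * x1^*%C.
  have -> : zonal_kernel q q.+2%:R q.+3%:R z x =
    q.+3%:R * ((x1 * z1^*%C + x0 * z0^*%C) * (a + b) ^+ q.+1 +
     (x1 * z1^*%C * z0 * x0^*%C - x1 * x1^*%C * z0 * z0^*%C
      - x0 * x0^*%C * z1 * z1^*%C + x0 * z0^*%C * z1 * x1^*%C) * (q.+1%:R * (a
        + b) ^+ q)).
    rewrite /zonal_kernel !natc /inner -/z0 -/z1 -/x0 -/x1 -/a -/b exprS.
    (* The constant [p] is homogenized by [|z|^2 |x|^2 = 1]. *)
    have h1 : q.+1%:R = q.+1%:R *
        ((z0 * z0^*%C + z1 * z1^*%C) * (x0 * x0^*%C + x1 * x1^*%C)).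
      by rewrite /z0 /z1 /x0 /x1 !coord_sphere !mulr1.
    have h2 : q.+2%:R = q.+1%:R + 1 :> R[i] by rewrite -natr1.
    by rewrite [X in _ - X]h1 h2 /a /b; ring.
  (* [c1] and [c2] collect what [conj z1 * d0] and [- conj z0 * d1] produce when they hit
     [(a + b) ^+ q.+1], hence the two differentiated binomial sums. *)
  pose c1 := x1 * z1^*%C * a - x0 * x0^*%C * (z1 * z1^*%C).
  pose c2 := x0 * z0^*%C * b - x1 * x1^*%C * (z0 * z0^*%C).
  transitivity (q.+3%:R * ((x1 * z1^*%C + x0 * z0^*%C) * (a + b) ^+ q.+1 +
      c1 * (q.+1%:R * (a + b) ^+ q) + c2 * (q.+1%:R * (a + b) ^+ q))).
    by rewrite /c1 /c2 /a /b; ring.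
  rewrite -[in c1 * _]binomial_sum_left -[in c2 * _]binomial_sum_right -binomial_sum.
  rewrite !mulr_sumr -!big_split /= mulr_sumr; apply: eq_bigr => k _.
  move: ('C(q.+1, k)%:R : R[i]) (q.+3%:R : R[i]) => C N.
  rewrite /plane_harmonic /r /plane_monom -/(scoord 0 z) -/(scoord 1 z) -/z0
    -/z1 -/x0 -/x1.
  move: (nat_of_ord k) (q.+1 - k)%N => i j.
  rewrite /c1 /c2 /a /b !exprMn; case: i => [|i]; case: j => [|j];
    rewrite -?natr1 /= ?exprS ?expr0; ring.
rewrite kE.
have sm c d f : (c + d)%N = q.+2 -> bnd f ->
    separable_in (supspace_set X) (fun z x => plane_harmonic c d (val z) * f x).
  move=> cd fb; apply: separable_inMr => //; apply: separable_in_left.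
  by exists (plane_harmonic c d) => //; exact: plane_harmonic_in.
apply: separable_in_sum => k; apply: separable_inD; apply: sm.
all: do ?[by apply: bndM; [apply: bndM => //; exact: bnd_cst|exact: bnd_coord]].
all: by rewrite ?addSn ?addnS subnKC// -ltnS.
Qed.

Lemma harmonic_proj_const : proj_const X =
  (radial_integral q q.+2%:R q.+3%:R)%:E.
Proof.
apply: zonal_proj_const => //; [by rewrite ler_nat|..].
- move=> _ [F [Fb Fh] <-]; exists F => // al be.
  exists (fun z => al * F z + 0).
    have F0 : bihomog q.+1 1 (fun z : V => al * F z + 0).
      by apply: bihomogDZ => //; exact: bihomog0.
    split=> [|z]; first exact: F0.
    rewrite (laplacian_lin al z (bihomog_rpoly Fb) (rpoly_cst 2 0)).
    by rewrite (Fh z) (laplacian0 z) mulr0 addr0.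
  by apply/funext => w; rewrite (Fh (val w)) mulr0.
- exact: harmonic_kernel_separable.
- move=> _ [F [Fb Fh] <-] z; rewrite mean_zonal_kernel// (Fh (val z)) !natc.
  have n0 k : (k.+1%:R : R[i]) != 0 by rewrite pnatr_eq0.
  have key (a N1 N2 N3 : R[i]) : N1 != 0 -> N2 != 0 -> N3 != 0 ->
      N3 * (N2 * ((a + 0) / (N2 * N3)) - N1 * (0 / (N1 * N2))) = a.
    by move=> h1 h2 h3; field; rewrite h1 h2 h3.
  exact: key.
Qed.

End Harmonic.
End TwoSpaces.

(** * Closed formulas and limits *)

Section Asymptotics.
Variable R : realType.

Lemma powR_half (x : R) n : 0 <= x -> x `^ (n%:R / 2) = Num.sqrt x ^+ n.
Proof. by move=> x0; rewrite mulrC powRrM powR12_sqrt// powR_mulrn ?sqrtr_ge0. Qed.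

(** The power of [p / A] is [sigma ^+ q.+4]; as [sigma^2 = p / A], the two terms of the primitive at
    [sigma] are multiples of it and merge. *)
Lemma radial_integralE q (A D : R) : 0 < A ->
  let p := q.+1%:R in
  radial_integral q A D = D * (8 * A / ((p + 1) * (p + 3)) * (p / A) `^ ((p + 3) / 2)
     + 2 * A / (p + 3) - 2 * p / (p + 1)).
Proof.
move=> A0 p; have p0 : 0 < p by rewrite ltr0n.
have q2 : q.+2%:R = p + 1 :> R by rewrite -natr1.
have q4 : q.+4%:R = p + 3 :> R by rewrite -[q.+4]addn3 natrD.
rewrite -q4 powR_half; last by rewrite divr_ge0 ?ltW.
rewrite /radial_integral /radial_primitive -/p.
rewrite !(hornerZ, hornerD, hornerN, hornerXn) !expr1n.
set w := Num.sqrt _; have w2 : w ^+ 2 = p / A by rewrite sqr_sqrtr// divr_ge0 ?ltW.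
have -> : w ^+ q.+4 = w ^+ q.+2 * (p / A) by rewrite -w2 -exprD addn2.
rewrite q2 q4; have h1 : p + 1 != 0 by rewrite lt0r_neq0// addr_gt0.
have h3 : p + 3 != 0 by rewrite lt0r_neq0// addr_gt0.
have key (P B E W : R) : B != 0 -> P + 1 != 0 -> P + 3 != 0 ->
    E * (2 * B / (P + 3) * 1 - 2 * P / (P + 1) * 1) -
    2 * (E * (2 * B / (P + 3) * (W * (P / B)) - 2 * P / (P + 1) * W)) =
    E * (8 * B / ((P + 1) * (P + 3)) * (W * (P / B)) + 2 * B / (P + 3) - 2 * P
      / (P + 1)).
  by move=> B0 P1 P3; field; rewrite B0 P1 P3.
by apply: key => //; rewrite lt0r_neq0.
Qed.

Lemma ratio_cvg (c : R) (d : nat) :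
  (n.+1%:R + c) / (n.+1%:R + d%:R) @[n --> \oo] --> (1 : R).
Proof.
have -> : (fun n => (n.+1%:R + c) / (n.+1%:R + d%:R)) =
    (fun n => 1 + (c - d%:R) * (n + d)%N.+1%:R^-1 : R).
  apply/funext => n.
  have E : (n + d)%N.+1%:R = n.+1%:R + d%:R :> R by rewrite -natrD addSn.
  have h : n.+1%:R + d%:R != 0 :> R by rewrite -E pnatr_eq0.
  by rewrite E; field.
rewrite -[X in _ --> X]addr0 -(mulr0 (c - d%:R)).
apply: cvgD; first exact: cvg_cst.
apply: cvgM; first exact: cvg_cst.
have := @cvg_harmonic R; rewrite -(cvg_shiftn d); exact.
Qed.

(** [ln (1 + t) <= t], applied to the quotient and to its inverse. *)
Lemma ln_quotient_bounds (x k : R) : 0 < x -> 0 <= k ->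
  - (k / x) <= ln (x / (x + k)) <= - (k / (x + k)).
Proof.
move=> x0 k0; have xk : 0 < x + k by rewrite ltr_wpDr.
have h1 : x != 0 by rewrite lt0r_neq0.
have h2 : x + k != 0 by rewrite lt0r_neq0.
apply/andP; split.
  rewrite -[x / _]invrK invf_div lnV ?posrE ?divr_gt0// lerN2.
  have -> : (x + k) / x = 1 + k / x by field.
  by apply: le_ln1Dx; apply: lt_le_trans (divr_ge0 k0 (ltW x0)); rewrite ltrN10.
have -> : x / (x + k) = 1 + - (k / (x + k)) by field.
apply: le_ln1Dx; rewrite ltrN2 ltr_pdivrMr// mul1r; lra.
Qed.

Lemma powR_quotient_cvg (k : nat) :
  (n.+1%:R / (n.+1%:R + k%:R)) `^ ((n.+1%:R + 3) / 2) @[n --> \oo] -->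
  expR (- (k%:R / 2) : R).
Proof.
have p0 n : 0 < n.+1%:R :> R by rewrite ltr0n.
have pk0 n : 0 < n.+1%:R + k%:R :> R by rewrite ltr_wpDr.
rewrite (_ : (fun n => _) = fun n => expR ((n.+1%:R + 3) / 2 *
    ln (n.+1%:R / (n.+1%:R + k%:R)))); last first.
  apply/funext => n; rewrite /powR gt_eqF//; exact: divr_gt0.
apply: (cvg_comp _ expR); last exact: continuous_expR.
have k2 : 0 <= k%:R / 2 :> R by rewrite divr_ge0.
(* Both bounds are [- k / 2] times a ratio tending to 1; [0%:R] gives the lower one the shape of
   [ratio_cvg]. *)
apply: (@squeeze_cvgr _ _ _ _
  (fun n => - (k%:R / 2) * ((n.+1%:R + 3) / (n.+1%:R + 0%:R)))
  (fun n => - (k%:R / 2) * ((n.+1%:R + 3) / (n.+1%:R + k%:R)))).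
- apply: nearW => n.
  have /andP[l u] := @ln_quotient_bounds n.+1%:R k%:R (p0 n) (ler0n _ _).
  have h : 0 <= (n.+1%:R + 3) / 2 :> R by rewrite divr_ge0 ?addr_ge0.
  have := ler_wpM2l h l; have := ler_wpM2l h u; rewrite addr0.
  have -> : (n.+1%:R + 3) / 2 * - (k%:R / n.+1%:R) =
    - (k%:R / 2) * ((n.+1%:R + 3) / n.+1%:R) :> R by rewrite !mulrN mulNr;
      congr (- _); ring.
  have -> : (n.+1%:R + 3) / 2 * - (k%:R / (n.+1%:R + k%:R)) =
    - (k%:R / 2) * ((n.+1%:R + 3) / (n.+1%:R + k%:R)) :> R
    by rewrite !mulrN mulNr; congr (- _); ring.
  by move=> -> ->.
- rewrite -[X in _ --> X]mulr1; apply: cvgM; [exact: cvg_cst|exact: ratio_cvg].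
- rewrite -[X in _ --> X]mulr1; apply: cvgM; [exact: cvg_cst|exact: ratio_cvg].
Qed.

Lemma sqrt_expR1 : Num.sqrt (expR 1) = expR (2^-1) :> R.
Proof.
have -> : expR 1 = expR (2^-1) ^+ 2 :> R by rewrite expr2 -expRD; congr expR; field.
by rewrite sqrtr_sqr ger0_norm ?expR_ge0.
Qed.

End Asymptotics.

Theorem proposition6p7 (R : realType) :
  (forall p : nat, (2 <= p)%N ->
     proj_const (harmonic_sphere R 2 p 1) =
       ((p%:R + 2) * (8 / (p%:R + 3) *
            (p%:R / (p%:R + 1)) `^ ((p%:R + 3) / 2)
          + 2 / (p%:R + 1) - 4 / (p%:R + 3)))%:E /\
     proj_const (bihomog_sphere R 2 p 1) =
       ((p%:R + 1) * (8 * (p%:R + 2) / ((p%:R + 1) * (p%:R + 3)) *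
            (p%:R / (p%:R + 2)) `^ ((p%:R + 3) / 2)
          + 4 / (p%:R + 1)
          - 4 * (p%:R + 2) / ((p%:R + 1) * (p%:R + 3))))%:E) /\
  proj_const (harmonic_sphere R 2 p 1) @[p --> \oo]
    --> (8 / Num.sqrt (expR 1) - 2)%:E /\
  proj_const (bihomog_sphere R 2 p 1) @[p --> \oo] --> (8 / expR 1)%:E.
Proof.
have natp2 q : q.+2%:R = q.+1%:R + 1 :> R by rewrite -natr1.
have natp3 q : q.+3%:R = q.+1%:R + 2 :> R by rewrite -natrD addn2.
have pos1 q : q.+1%:R + 1 != 0 :> R by rewrite natr1 pnatr_eq0.
have pos3 q : q.+1%:R + 3 != 0 :> R by rewrite -natrD pnatr_eq0.
have harmE q : proj_const (harmonic_sphere R 2 q.+1 1) =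
    ((q.+1%:R + 2) * (8 / (q.+1%:R + 3) *
            (q.+1%:R / (q.+1%:R + 1)) `^ ((q.+1%:R + 3) / 2)
          + 2 / (q.+1%:R + 1) - 4 / (q.+1%:R + 3)))%:E.
  rewrite harmonic_proj_const radial_integralE//; congr (_ %:E).
  rewrite (natp3 q) (natp2 q).
  move: (pos1 q) (pos3 q) (_ `^ _); move: (q.+1%:R) => x h1 h3 w.
  by field; rewrite h1 h3.
have bihomE q : proj_const (bihomog_sphere R 2 q.+1 1) =
    ((q.+1%:R + 1) * (8 * (q.+1%:R + 2) / ((q.+1%:R + 1) * (q.+1%:R + 3)) *
            (q.+1%:R / (q.+1%:R + 2)) `^ ((q.+1%:R + 3) / 2)
          + 4 / (q.+1%:R + 1)
          - 4 * (q.+1%:R + 2) / ((q.+1%:R + 1) * (q.+1%:R + 3))))%:E.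
  rewrite bihomog_proj_const radial_integralE//; congr (_ %:E).
  rewrite (natp3 q) (natp2 q).
  move: (pos1 q) (pos3 q) (_ `^ _); move: (q.+1%:R) => x h1 h3 w.
  by field; rewrite h1 h3.
split; first by case=> [|p].
(* The closed formulas hold at [p = q.+1], so the limits are taken along the shifted sequences. *)
split; rewrite -cvg_shiftS.
- under eq_fun do rewrite harmE.
  apply: cvg_EFin; first exact: nearW.
  rewrite (_ : _ \o _ = fun n => 8 * ((n.+1%:R + 2) / (n.+1%:R + 3)) *
      (n.+1%:R / (n.+1%:R + 1)) `^ ((n.+1%:R + 3) / 2) +
      2 * ((n.+1%:R + 2) / (n.+1%:R + 1)) -
      4 * ((n.+1%:R + 2) / (n.+1%:R + 3))); last first.
    apply/funext => n /=.
    move: (pos1 n) (pos3 n) (_ `^ _); move: (n.+1%:R) => x h1 h3 w.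
    by field; rewrite h1 h3.
  have -> : 8 / Num.sqrt (expR 1) - 2 = 8 * 1 * expR (- (1%:R / 2)) + 2 * 1 - 4
    * 1 :> R.
    by rewrite sqrt_expR1 mul1r expRN; ring.
  apply: cvgB; [apply: cvgD|]; apply: cvgM; do ?exact: cvg_cst; do ?exact: ratio_cvg.
  - by apply: cvgM; [exact: cvg_cst|exact: ratio_cvg].
  - exact: (@powR_quotient_cvg _ 1).
  - exact: (@ratio_cvg _ 2 1).
- under eq_fun do rewrite bihomE.
  apply: cvg_EFin; first exact: nearW.
  rewrite (_ : _ \o _ = fun n => 8 * ((n.+1%:R + 2) / (n.+1%:R + 3)) *
      (n.+1%:R / (n.+1%:R + 2)) `^ ((n.+1%:R + 3) / 2) + 4 -
      4 * ((n.+1%:R + 2) / (n.+1%:R + 3))); last first.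
    apply/funext => n /=.
    move: (pos1 n) (pos3 n) (_ `^ _); move: (n.+1%:R) => x h1 h3 w.
    by field; rewrite h1 h3.
  have -> : 8 / expR 1 = 8 * 1 * expR (- (2%:R / 2)) + 4 - 4 * 1 :> R.
    by rewrite divff// expRN; ring.
  apply: cvgB; [apply: cvgD|]; do ?exact: cvg_cst.
    apply: cvgM; last exact: powR_quotient_cvg.
    by apply: cvgM; [exact: cvg_cst|exact: ratio_cvg].
  by apply: cvgM; [exact: cvg_cst|exact: ratio_cvg].
Qed.
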